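(* Let $A$ be a self-adjoint operator on an infinite-dimensional Hilbert space $\mathcal{H}$, $B\ne0$ a bounded, symmetric, non-negative operator on $\mathcal{H}$, $a\in\sigma_{\mathrm{ess}}(A)$, $b>a$ such that $(a,b)\cap\sigma_{\mathrm{ess}}(A)=\emptyset$, $t_0=(b-a)/\lVert B\rVert$, and $\kappa\ge0$. Assume that $$\forall x\in\bigcup_{t\in[0,1]}\operatorname{Ran}P_{A+tB}(b):\quad\langle x,Bx\rangle\ge\kappa\lVert x\rVert^2.$$ Then $f(t)=\sup\bigl(\sigma_{\mathrm{ess}}(A+tB)\cap(-\infty,b)\bigr)$ satisfies $$\kappa\,\epsilon\ \le\ f(t+\epsilon)-f(t)\ \le\ \lVert B\rVert\,\epsilon\qquad\text{for all }t\in[0,t_0)\text{ and }\epsilon\in[0,t_0-t).$$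
   Context: For a self-adjoint operator $T$ and $E\in\mathbb{R}$, $P_T(E)=\mathbf{1}_{(-\infty,E]}(T)$ denotes the spectral projection of $T$ associated to the interval $(-\infty,E]$, and $\operatorname{Ran}$ denotes the range; $\sigma_{\mathrm{ess}}$ denotes the essential spectrum. The operator $A$ need not be semi-bounded.
   Formalization: The lower bound κε ≤ f(t+ε) − f(t) is asserted only when t+ε ≤ 1, the range of couplings covered by the assumption on Ran P_{A+tB}(b); for t_0 > 1 the bound as printed can fail beyond that range. *)

(* Defs.v *)
From HB Require Import structures.
From mathcomp Require Import all_boot all_order all_algebra sesquilinear complex.
From mathcomp Require Import all_classical all_reals all_analysis.

Set Implicit Arguments.
Unset Strict Implicit.
Unset Printing Implicit Defensive.

Import Order.TTheory GRing.Theory Num.Theory.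
Import numFieldNormedType.Exports.

Local Open Scope complex_scope.
Local Open Scope classical_set_scope.
Local Open Scope ring_scope.

(* A complex Hilbert space is a complete normed space [H] over [R[i]] together
   with a positive definite Hermitian form [ip] (linear in the first argument,
   conjugate-linear in the second) inducing the norm.  Norms live in [R[i]],
   whose order relates only numbers with equal imaginary parts; an inequality
   [c%:C <= ip x y] thus includes that [ip x y] is real. *)
Definition hilbert_product (R : realType) (H : completeNormedModType R[i])
    (ip : {dot H for (@Num.conj R[i])}) : Prop :=
  forall x : H, ip x x = `|x| ^+ 2.

Section FiniteDimension.
Context {R : realType} {H : completeNormedModType R[i]}.

Definition finite_dim (V : set H) : Prop :=
  exists (n : nat) (v : 'I_n -> H), forall x, V x ->
    exists c : 'I_n -> R[i], x = \sum_(i < n) c i *: v i.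

End FiniteDimension.

(* A possibly unbounded operator; the values of [op_fun] outside [op_dom] are
   irrelevant. *)
Record operator (R : realType) (H : completeNormedModType R[i]) := Operator {
  op_dom : set H;
  op_fun :> H -> H }.

Section Operators.
Context {R : realType} {H : completeNormedModType R[i]}.
Variable ip : {dot H for (@Num.conj R[i])}.
Implicit Types (T : operator H) (B : {linear H -> H}).

Definition linear_op T : Prop :=
  op_dom T 0 /\
  forall (c : R[i]) (x y : H), op_dom T x -> op_dom T y ->
    op_dom T (c *: x + y) /\ T (c *: x + y) = c *: T x + T y.

(* [adjoint_graph T y z] states that [y] is in the domain of the adjoint of [T]
   and that the adjoint maps [y] to [z]. *)
Definition adjoint_graph T (y z : H) : Prop :=
  forall x, op_dom T x -> ip (T x) y = ip x z.

Definition self_adjoint T : Prop :=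
  [/\ linear_op T, dense (op_dom T) &
      forall y z, adjoint_graph T y z <-> (op_dom T y /\ T y = z)].

Definition symmetric_op B : Prop := forall x y, ip (B x) y = ip x (B y).

Definition nonneg_op B : Prop := forall x, 0 <= ip x (B x).

Definition opnorm B : R := sup [set complex.Re `|B x| | x in [set x | `|x| <= 1]].

Definition perturb T B (t : R) : operator H :=
  Operator (op_dom T) (fun x => T x + t%:C *: B x).

Definition resolvent_set T : set R[i] :=
  [set z | exists S : {linear H -> H},
    [/\ continuous S,
        forall y, op_dom T (S y) /\ T (S y) - z *: S y = y &
        forall x, op_dom T x -> S (T x - z *: x) = x]].

Definition spectrum T : set R[i] := ~` resolvent_set T.

Definition eigenspace T (z : R[i]) : set H :=
  [set x | op_dom T x /\ T x = z *: x].

(* Isolated points of the spectrum that are eigenvalues of finite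
   multiplicity. *)
Definition discrete_spectrum T : set R[i] :=
  [set z | [/\ isolated (spectrum T : set R[i]^o) z,
               exists2 x, eigenspace T z x & x != 0 &
               finite_dim (eigenspace T z)]].

Definition ess_spectrum T : set R[i] := spectrum T `\` discrete_spectrum T.

Definition orth_projection (Q : H -> H) : Prop :=
  [/\ forall (c : R[i]) x y, Q (c *: x + y) = c *: Q x + Q y,
      forall x, Q (Q x) = Q x &
      forall x y, ip (Q x) y = ip x (Q y)].

(* [E] is the spectral family (right-continuous resolution of the identity) of
   [T], that is, [E l] is the indicator function of ]-oo, l] applied to [T].
   The last field says that [T] is the integral of [l] against [E]: [mu] is the
   Lebesgue-Stieltjes measure of [l |-> ip (E l x) x], and [T], being
   determined by its domain and its quadratic form, is given by the integrals
   of [l ^+ 2] and [l].  By the spectral theorem a self-adjoint operator has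
   exactly one spectral family. *)
Record spectral_family T (E : R -> H -> H) : Prop := {
  spectral_family_proj : forall l, orth_projection (E l);
  spectral_family_mono : forall l m x, l <= m -> E l (E m x) = E l x;
  spectral_family_right : forall (l : R) x, E m x @[m --> l^'+] --> E l x;
  spectral_family_ninfty : forall x, E m x @[m --> -oo] --> (0 : H);
  spectral_family_pinfty : forall x, E m x @[m --> +oo] --> x;
  spectral_family_integral : forall x,
    exists mu : {measure set (measurableTypeR R) -> \bar R},
      [/\ forall l : R, ip (E l x) x = (fine (mu `]-oo, l]%classic))%:C /\
                        (mu `]-oo, l]%classic < +oo)%E,
          op_dom T x <-> (\int[mu]_l (l ^+ 2)%:E < +oo)%E &
          op_dom T x -> ip (T x) x = (\int[mu]_l l)%R%:C] }.

End Operators.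

(* Main.v *)
From HB Require Import structures.
Require Import Defs.
From mathcomp Require Import all_boot all_order all_algebra sesquilinear complex.
From mathcomp Require Import all_classical all_reals all_analysis.
From mathcomp Require Import measurable_realfun ring lra.
Import Order.TTheory GRing.Theory Num.Theory.
Import numFieldNormedType.Exports.
Local Open Scope complex_scope.
Local Open Scope classical_set_scope.
Local Open Scope ring_scope.

(** Let [T = A + t B] with spectral family [E], and [T' = T + eps B] with spectral
family [E'].  A real number [c] lies in the essential spectrum of [T] exactly
when every spectral band [Ran (E (c + d) - E (c - d))], [d > 0], is infinite
dimensional ([ess_point_spectrum], [ess_spectrum_point]).  Compactness of an
interval then turns a gap of the essential spectrum into finite-dimensional
bands ([gap_finite]).  So if [T] has essential spectrum at [c] and [T'] has a
gap, or conversely, an infinite-dimensional band of the one contains a nonzero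
vector [x] orthogonal to a finite-dimensional band [(l, m]] of the other
([exists_off_band]).  Such an [x] is almost an eigenvector of the first
operator, and splits as [x = y + z] with [y] below [l] and [z] above [m] for
the second one.  All that remains is to compare quadratic forms on [y] and
[z], where [0 <= B <= |B|].

For the upper bound ([gap_upper_edge]), let [x] be an approximate eigenvector
of [T'] at [c], with [c] in [(al + eps |B|, b)], and let [(l, m]] be a band in
the gap [(al, b)] of [T].  The two form inequalities give
[(c - l - eps |B|) |y|^2 + (m - c) |z|^2 <= small |x|^2], a contradiction once
[l] and [m] are close to [al] and [b].

For the lower bound ([gap_lower_edge]), let [x] be an approximate eigenvector
of [T] at [al], and suppose that [T'] has no essential spectrum in
[[al + eps kappa, b)].  Then
[(m - al) |z|^2 <= <(T' - al) z, z> = eps (<B y, z> + <B z, z>) + small], and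
[m - al > eps |B|] forces the cross term [<B y, z>] to be almost nonnegative.
Hence [<(T' - al) y, y> = eps (<B y, y> + <B z, y>) + small] is at least
[eps kappa |y|^2], up to a small error, while [y] lies below some
[l < al + eps kappa]; and [y] is not small since [|z| <= q |x|] with [q < 1].

The rest is the spectral calculus needed for this.  The measures of a spectral
family are determined by their distribution functions, so that the quadratic
form of [T] splits along [E l] ([split_dom_form]); self-adjointness upgrades
this to [T E l = E l T] ([spec_op]), and the support of the measures bounds the
form on the ranges of [E l] and [1 - E l] ([form_le], [form_ge]).  Resolvent
points come from lower bounds on [T - z] through the projection theorem
([projection_theorem], [bounded_below_resolvent]). *)

Set Implicit Arguments.
Unset Strict Implicit.
Unset Printing Implicit Defensive.

(** * Inner product and norm in real terms *)

Section InnerProduct.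
Context {R : realType} {H : completeNormedModType R[i]}.
Variable ip : {dot H for (@Num.conj R[i])}.
Hypothesis hip : hilbert_product ip.

(** The order of the complex numbers only compares numbers with equal imaginary
    parts; estimates are carried out with the real part of the inner product and
    with the norm as a real number. *)
Definition rip (x y : H) : R := complex.Re (ip x y).
Definition nm (x : H) : R := complex.Re `|x|.

Lemma ReM_real (t : R) (z : R[i]) : complex.Re (t%:C * z) = t * complex.Re z.
Proof. by case: z => u v /=; rewrite mul0r subr0. Qed.

Lemma ReD (z w : R[i]) : complex.Re (z + w) = complex.Re z + complex.Re w.
Proof. by case: z => ? ?; case: w. Qed.

Lemma ReN (z : R[i]) : complex.Re (- z) = - complex.Re z.
Proof. by case: z. Qed.

Lemma Re_conj (z : R[i]) : complex.Re (Num.conj z) = complex.Re z.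
Proof. by case: z. Qed.

Lemma conj_real (t : R) : Num.conj (t%:C : R[i]) = t%:C.
Proof. by apply/eqP; rewrite eq_complex/= oppr0 !eqxx. Qed.

Lemma ipC x y : ip x y = Num.conj (ip y x).
Proof. by rewrite hermC expr0 mul1r. Qed.

Lemma ripC x y : rip x y = rip y x.
Proof. by rewrite /rip ipC Re_conj. Qed.

Lemma ripDl x y z : rip (x + y) z = rip x z + rip y z.
Proof. by rewrite /rip linearDl ReD. Qed.

Lemma ripNl x z : rip (- x) z = - rip x z.
Proof. by rewrite /rip linearNl ReN. Qed.

Lemma ripBl x y z : rip (x - y) z = rip x z - rip y z.
Proof. by rewrite ripDl ripNl. Qed.

Lemma ripZl t x z : rip (t%:C *: x) z = t * rip x z.
Proof. by rewrite /rip linearZl_LR ReM_real. Qed.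

Lemma ripDr x y z : rip z (x + y) = rip z x + rip z y.
Proof. by rewrite ripC ripDl !(ripC z). Qed.

Lemma ripNr x z : rip z (- x) = - rip z x.
Proof. by rewrite ripC ripNl !(ripC z). Qed.

Lemma ripZr t x z : rip z (t%:C *: x) = t * rip z x.
Proof. by rewrite ripC ripZl ripC. Qed.

Lemma rip0l x : rip 0 x = 0.
Proof. by rewrite /rip linear0l. Qed.

Lemma rip0r x : rip x 0 = 0.
Proof. by rewrite ripC rip0l. Qed.

Lemma ipDl x y z : ip (x + y) z = ip x z + ip y z.
Proof. exact: linearDl. Qed.

Lemma ip0l x : ip 0 x = 0.
Proof. exact: linear0l. Qed.

Lemma ip0r x : ip x 0 = 0.
Proof. exact: linear0r. Qed.

Lemma ipDr x y z : ip z (x + y) = ip z x + ip z y.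
Proof. exact: linearDr. Qed.

Lemma ipZr c x y : ip y (c *: x) = Num.conj c * ip y x.
Proof. exact: linearZr_LR. Qed.

Lemma ipNl x y : ip (- x) y = - ip x y.
Proof. exact: linearNl. Qed.

Lemma ipNr x y : ip y (- x) = - ip y x.
Proof. exact: linearNr. Qed.

Lemma ipZl c x y : ip (c *: x) y = c * ip x y.
Proof. exact: linearZl_LR. Qed.

(** Multiplying the first argument by [i] turns the imaginary part of the inner
    product into a real part: an identity between real parts that holds on a
    complex subspace is an identity between inner products. *)
Lemma ip_eq0 x y : rip x y = 0 -> rip ('i%C *: x) y = 0 -> ip x y = 0.
Proof.
rewrite /rip ipZl; case: (ip x y) => u v /= ->.
by rewrite mul0r mul1r sub0r => /eqP; rewrite oppr_eq0 => /eqP ->.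
Qed.

Lemma normE (x : H) : `|x| = (nm x)%:C.
Proof. by rewrite /nm RRe_real// ger0_real. Qed.

Lemma nm_ge0 x : 0 <= nm x.
Proof. by have := normr_ge0 x; rewrite normE lecR. Qed.

Lemma rip_nm x : rip x x = nm x ^+ 2.
Proof. by rewrite /rip hip normE -rmorphXn. Qed.

Lemma nm_eq0 x : (nm x == 0) = (x == 0).
Proof. by rewrite -(normr_eq0 x) normE eq_complex/= eqxx andbT. Qed.

Lemma nm_gt0 x : (0 < nm x) = (x != 0).
Proof. by rewrite lt_def nm_eq0 nm_ge0 andbT. Qed.

Lemma nm0 : nm 0 = 0. Proof. by rewrite /nm normr0. Qed.

Lemma nmN x : nm (- x) = nm x. Proof. by rewrite /nm normrN. Qed.

Lemma nmB x y : nm (x - y) = nm (y - x). Proof. by rewrite /nm distrC. Qed.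

Lemma nmD x y : nm (x + y) <= nm x + nm y.
Proof. by have := ler_normD x y; rewrite !normE -rmorphD/= lecR. Qed.

Lemma nmZC (c : R[i]) x : nm (c *: x) = complex.Re `|c| * nm x.
Proof.
by rewrite {1}/nm normrZ normE -{1}[`|c|]RRe_real ?ReM_real// ger0_real.
Qed.

Lemma nmZ (t : R) x : nm (t%:C *: x) = `|t| * nm x.
Proof. by rewrite nmZC normc_def/= expr0n/= addr0 sqrtr_sqr. Qed.

Lemma nm_sqrD x y : nm (x + y) ^+ 2 = nm x ^+ 2 + nm y ^+ 2 + rip x y *+ 2.
Proof.
by rewrite -!rip_nm !(ripDl, ripDr) (ripC y x) mulr2n; ring.
Qed.

Lemma nm_sqrB x y : nm (x - y) ^+ 2 = nm x ^+ 2 + nm y ^+ 2 - rip x y *+ 2.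
Proof. by rewrite nm_sqrD nmN ripNr mulNrn. Qed.

(** Expand the square norm of [|y| x - |x| y]. *)
Lemma rip_le x y : rip x y <= nm x * nm y.
Proof.
have [->|x0] := eqVneq x 0; first by rewrite rip0l nm0 mul0r.
have [->|y0] := eqVneq y 0; first by rewrite rip0r nm0 mulr0.
have xy0 : 0 < nm x * nm y by rewrite mulr_gt0// nm_gt0.
have := sqr_ge0 (nm ((nm y)%:C *: x - (nm x)%:C *: y)).
rewrite nm_sqrB !nmZ !ger0_norm ?nm_ge0// ripZl ripZr => h.
rewrite -(ler_pM2l xy0); lra.
Qed.

Lemma rip_ge x y : - (nm x * nm y) <= rip x y.
Proof. by rewrite lerNl -ripNl -(nmN x) rip_le. Qed.

Lemma pythag x y : rip x y = 0 -> nm (x + y) ^+ 2 = nm x ^+ 2 + nm y ^+ 2.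
Proof. by rewrite nm_sqrD => ->; rewrite mul0rn addr0. Qed.

End InnerProduct.

(** * Finite-dimensional subspaces *)

Section FiniteDimensionTheory.
Context {R : realType} {H : completeNormedModType R[i]}.
Variable ip : {dot H for (@Num.conj R[i])}.

Definition lin_subspace (V : set H) : Prop :=
  V 0 /\ forall (c : R[i]) x y, V x -> V y -> V (c *: x + y).

Definition spanned n (V : set H) : Prop :=
  exists v : 'I_n -> H, forall x, V x ->
    exists c : 'I_n -> R[i], x = \sum_(i < n) c i *: v i.

Lemma spanned_sub n (V W : set H) : W `<=` V -> spanned n V -> spanned n W.
Proof. by move=> WV [v hv]; exists v => x /WV /hv. Qed.

Lemma finite_dim_sub (V W : set H) : W `<=` V -> finite_dim V -> finite_dim W.
Proof. by move=> WV [n /(spanned_sub WV) h]; exists n. Qed.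

Lemma spanned0 (V : set H) : (forall x, V x -> x = 0) -> spanned 0 V.
Proof.
move=> V0; exists (fun=> 0) => x /V0 ->.
by exists (fun=> 0); rewrite big_ord0.
Qed.

Lemma finite_dim_add (U V W : set H) : finite_dim U -> finite_dim V ->
  (forall x, W x -> exists u v, [/\ U u, V v & x = u + v]) -> finite_dim W.
Proof.
move=> [n [u hu]] [m [v hv]] hW; exists (n + m)%N.
exists (fun k => match fintype.split k with inl i => u i | inr j => v j end).
move=> x /hW [y [z [/hu[c ->] /hv[d ->] ->]]].
exists (fun k => match fintype.split k with inl i => c i | inr j => d j end).
rewrite big_split_ord/=; congr (_ + _); apply: eq_bigr => i _.
  by case: split_ordP => j; [move/lshift_inj <-|move/eqP; rewrite eq_lrshift].
by case: split_ordP => j; [move/eqP; rewrite eq_rlshift|move/rshift_inj <-].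
Qed.

(** The kernel of a functional has codimension at most one: a vector outside it
    supplies the missing direction. *)
Lemma finite_dim_ker (V : set H) (phi : H -> R[i]) : lin_subspace V ->
  (forall c x y, phi (c *: x + y) = c * phi x + phi y) ->
  finite_dim [set x | V x /\ phi x = 0] -> finite_dim V.
Proof.
move=> [V0 VP] phiP fV.
have [phi0|/existsNP[v0 /not_implyP[Vv0 /eqP phi0]]] :=
  pselect (forall x, V x -> phi x = 0).
  by apply: finite_dim_sub fV => x Vx; split=> //; exact: phi0.
apply: (@finite_dim_add [set x | V x /\ phi x = 0] [set c *: v0 | c in setT]) => //.
  exists 1%N, (fun=> v0) => _ [c _ <-]; exists (fun=> c).
  by rewrite big_ord_recl big_ord0 addr0.
move=> x Vx; exists (x - (phi x / phi v0) *: v0), ((phi x / phi v0) *: v0).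
split; last by rewrite subrK.
  rewrite addrC -scaleNr; split; first exact: VP.
  by rewrite phiP mulNr divfK// addNr.
by exists (phi x / phi v0).
Qed.

Lemma ip_lin c x y z : ip (c *: x + y) z = c * ip x z + ip y z.
Proof. by rewrite ipDl ipZl. Qed.

(** Induction on the number of orthogonality conditions, each of which cuts out
    the kernel of a functional. *)
Lemma finite_dim_orth (V : set H) (s : seq H) : lin_subspace V ->
  finite_dim [set x | V x /\ forall w, w \in s -> ip x w = 0] -> finite_dim V.
Proof.
elim: s V => [|w s ih] V sV fV.
  by apply: finite_dim_sub fV => x Vx; split.
apply: (@finite_dim_ker _ (ip^~ w)) => //.
  by move=> c x y; exact: ip_lin.
apply: ih.
  case: sV => V0 VP; split; first by split => //=; rewrite ip0l.
  move=> c x y [Vx x0] [Vy y0]; split; first exact: VP.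
  by rewrite ip_lin x0 y0 mulr0 addr0.
apply: finite_dim_sub fV => x [[Vx xw] xs]; split=> // u.
by rewrite inE => /orP[/eqP ->//|/xs].
Qed.

Lemma projP (Q : H -> H) : orth_projection ip Q ->
  [/\ forall x y, Q (x + y) = Q x + Q y, forall x, Q (- x) = - Q x, Q 0 = 0 &
      forall c x, Q (c *: x) = c *: Q x].
Proof.
move=> [lin _ _].
have Q0 : Q 0 = 0.
  by have := lin (-1) 0 0; rewrite scaler0 addr0 scaleN1r addNr.
have QZ c x : Q (c *: x) = c *: Q x.
  by have := lin c x 0; rewrite !addr0 Q0 addr0.
split=> // [x y|x]; first by have := lin 1 x y; rewrite !scale1r.
by rewrite -scaleN1r QZ scaleN1r.
Qed.

Lemma proj_sum (Q : H -> H) n (c : 'I_n -> R[i]) v : orth_projection ip Q ->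
  Q (\sum_(i < n) c i *: v i) = \sum_(i < n) c i *: Q (v i).
Proof.
move=> /projP[QD _ Q0 QZ].
by elim/big_rec2: _ => [|i x y _ <-]; rewrite ?Q0// QD QZ.
Qed.

(** Since [Q] is an orthogonal projection, [Q x = 0] amounts to orthogonality to
    the images under [Q] of finitely many vectors spanning its range. *)
Lemma exists_in_kernel (V : set H) (Q : H -> H) : lin_subspace V ->
  ~ finite_dim V -> orth_projection ip Q -> finite_dim (range Q) ->
  exists x, [/\ V x, x != 0 & Q x = 0].
Proof.
move=> sV iV pQ [n [v hv]]; apply: contrapT => nex; apply: iV.
have [QL QQ QS] := pQ.
apply: (@finite_dim_orth _ [seq Q (v i) | i <- enum 'I_n]) => //.
exists 0%N; apply: spanned0 => x [Vx xs].
apply: contrapT => /eqP x0; apply: nex; exists x; split=> //.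
have [c Qx] := hv (Q x) (imageT _ _).
apply/eqP; rewrite -(dnorm_eq0 ip); apply/eqP.
rewrite QS QQ -[in ip _ _]QQ Qx (proj_sum _ _ pQ) linear_sumr big1//= => i _.
rewrite linearZr_LR/= xs ?mulr0//; apply/mapP; exists i => //.
exact: mem_enum.
Qed.

(** Dimension drop without dimensions: some coefficient of [v] on the spanning
    family is nonzero, so the corresponding vector can be traded for [v], and the
    orthogonal projection along [v] removes [v] while fixing [W]. *)
Lemma spanned_drop n (V W : set H) v : spanned n.+1 V -> W `<=` V ->
  V v -> v != 0 -> (forall w, W w -> ip w v = 0) -> spanned n W.
Proof.
move=> [u hu] WV Vv v0 orth; have [c vE] := hu v Vv.
have [j cj0] : exists j, c j != 0.
  apply: contrapT => nex; move/eqP: v0; apply; rewrite vE big1// => i _.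
  have [->|ci] := eqVneq (c i) 0; first by rewrite scale0r.
  by exfalso; apply: nex; exists i.
pose p x := x - (ip x v / ip v v) *: v.
have pL a x y : p (a *: x + y) = a *: p x + p y.
  rewrite /p ip_lin mulrDl scalerDl scalerBr scalerA mulrA opprD.
  by rewrite [in RHS]addrACA.
have p0 : p 0 = 0 by rewrite /p ip0l mul0r scale0r subr0.
have pv : p v = 0 by rewrite /p divff ?dnorm_eq0// scale1r subrr.
have p_sum m (b : 'I_m -> R[i]) (w : 'I_m -> H) :
    p (\sum_(i < m) b i *: w i) = \sum_(i < m) b i *: p (w i).
  by elim/big_rec2: _ => [//|i x y _ <-]; rewrite pL.
exists (fun i => p (u (lift j i))) => w Ww.
have [b wE] := hu w (WV _ Ww).
have pw : p w = w by rewrite /p orth// mul0r scale0r subr0.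
have E : w = p ((- (b j / c j)) *: v + w) by rewrite pL pv scaler0 add0r pw.
exists (fun i => - (b j / c j) * c (lift j i) + b (lift j i)).
rewrite E {1}vE wE scaler_sumr -big_split/= (bigD1_ord j)//=.
rewrite scalerA -scalerDl mulNr divfK// addNr scale0r add0r.
rewrite -p_sum; congr p; apply: eq_bigr => i _.
by rewrite scalerA -scalerDl.
Qed.

End FiniteDimensionTheory.

(** * Local-to-global principle and the projection theorem *)

Section RealLemmas.
Context {R : realType}.

Lemma le_small_eq0 (r C : R) : (forall n : nat, r <= C / n.+1%:R) -> r <= 0.
Proof.
move=> h; rewrite leNgt; apply/negP => r0.
have C0 : 0 < C by have := h 0%N; rewrite divr1; exact: lt_le_trans.
have [n hn] : exists n : nat, C / r < n%:R.
  by exists (Num.truncn (C / r)).+1; rewrite truncnS_gt.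
have := h n; rewrite ler_pdivlMr ?ltr0n//; apply/negP; rewrite -ltNge.
rewrite mulrC -ltr_pdivrMr//; apply: (lt_trans hn).
by rewrite ltr_nat.
Qed.

(** Compactness of a closed interval, in the form of Cousin's lemma: the supremum
    of the [k] such that [Q l k] holds can neither lie before [m] nor fail to be
    attained. *)
Lemma local_to_global (Q : R -> R -> Prop) (l m : R) : l <= m ->
  (forall x y x' y', x <= x' -> x' <= y' -> y' <= y -> Q x y -> Q x' y') ->
  (forall x y z, x <= y -> y <= z -> Q x y -> Q y z -> Q x z) ->
  (forall c, l <= c <= m -> exists2 d, 0 < d & Q (c - d) (c + d)) -> Q l m.
Proof.
move=> lm Qs Qa Ql; pose S := [set k | l <= k <= m /\ Q l k].
have Sl : S l.
  split; first by rewrite lexx.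
  have [d d0 h] := Ql l ltac:(by rewrite lexx lm).
  apply: Qs h; lra.
have hS : has_sup S by split; [exists l | exists m => k [/andP[]]].
have ls : l <= sup S by apply: ub_le_sup => //; case: hS.
have sm : sup S <= m by apply: ge_sup; [exists l|move=> k [/andP[]]].
have [d d0 Qd] := Ql (sup S) ltac:(by rewrite ls sm).
have [k [/andP[lk km] Qk] ks] := sup_adherent d0 hS.
have ks' : k <= sup S by apply: ub_le_sup; [case: hS|split=> //; rewrite lk].
pose z := Num.min m (sup S + d).
have kz : k <= z by rewrite le_min km/=; lra.
have Qlz : Q l z.
  apply: (Qa l k z) => //; apply: Qs Qd => //; first lra.
  by rewrite ge_min lexx orbT.
have : z <= sup S.
  apply: ub_le_sup; first by case: hS.
  by split=> //; rewrite (le_trans lk kz)/= ge_min lexx.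
rewrite ge_min => /orP[ms|]; last by move=> ?; exfalso; lra.
by move: Qlz; rewrite /z min_l//; lra.
Qed.

End RealLemmas.

Section Completeness.
Context {R : realType} {H : completeNormedModType R[i]}.
Variable ip : {dot H for (@Num.conj R[i])}.
Hypothesis hip : hilbert_product ip.

Lemma cvg_nm {T} {F : set_system T} {FF : Filter F} (u : T -> H) (x : H) :
  u @ F --> x <-> (forall e : R, 0 < e -> \forall t \near F, nm (x - u t) < e).
Proof.
split=> [/cvgrPdist_lt h e e0|h].
  have := h e%:C; rewrite ltcR => /(_ e0).
  by apply: filterS => t; rewrite normE ltcR.
apply/cvgrPdist_lt => e e0.
have eE : e = (complex.Re e)%:C by rewrite RRe_real// gtr0_real.
rewrite eE in e0 *; rewrite ltcR in e0.
by apply: filterS (h _ e0) => t; rewrite normE ltcR.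
Qed.

(** Completeness of the space with an explicit rate, which spares filters in the
    arguments on minimizing and approximating sequences. *)
Lemma complete_rate (C : R) (u : nat -> H) :
  (forall n m, nm (u n - u m) <= C / n.+1%:R + C / m.+1%:R) ->
  exists x, forall n, nm (u n - x) <= C *+ 2 / n.+1%:R.
Proof.
move=> h.
have C0 : 0 <= C.
  have := le_trans (nm_ge0 _) (h 0%N 0%N); rewrite !divr1; lra.
have near_small (e : R) :
    0 < e -> exists N, forall n, (N <= n)%N -> C / n.+1%:R < e.
  move=> e0; exists (Num.truncn (C / e)) => n Nn.
  rewrite ltr_pdivrMr ?ltr0n// mulrC -ltr_pdivrMr//.
  apply: (lt_le_trans (truncnS_gt _)); rewrite ler_nat ltnS//.
have mono n m : (n <= m)%N -> C / m.+1%:R <= C / n.+1%:R.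
  by move=> nm; rewrite ler_wpM2l// lef_pV2 ?posrE ?ltr0n// ler_nat.
have cu : cvgn u.
  apply: cauchy_cvg; apply: cauchy_exP => e e0.
  have eE : e = (complex.Re e)%:C by rewrite RRe_real// gtr0_real.
  rewrite eE in e0 *; rewrite ltcR in e0.
  have [|N hN] := near_small (complex.Re e / 2); first lra.
  exists (u N); exists N => // n /= Nn; rewrite -ball_normE/= normE ltcR.
  apply: (le_lt_trans (h _ _)).
  have := hN N (leqnn _); have := hN n Nn.
  by move: (C / n.+1%:R) (C / N.+1%:R) => p q; lra.
exists (limn u) => n; apply/ler_addgt0Pr => e e0.
have /cvg_nm/(_ e e0) [N _ hN] := cu.
have := hN (maxn N n) (leq_maxl _ _); rewrite /= nmB => h1.
have -> : u n - limn u = (u n - u (maxn N n)) + (u (maxn N n) - limn u).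
  by rewrite addrA subrK.
apply: (le_trans (nmD _ _)); apply: lerD; last exact: ltW.
apply: (le_trans (h _ _)); have := mono _ _ (leq_maxr N n).
by rewrite mulr2n mulrDl lerD2l.
Qed.

(** A sequence in [V] minimizing the distance to [y] is Cauchy by the
    parallelogram identity, and [y] minus its limit is orthogonal to [V]. *)
Lemma projection_theorem (V : set H) : lin_subspace V ->
  (forall y, (forall e : R, 0 < e -> exists2 v, V v & nm (y - v) < e) -> V y) ->
  (forall y, (forall v, V v -> ip v y = 0) -> y = 0) -> forall y, V y.
Proof.
move=> [V0 VP] clV trivV y.
have VZ c v : V v -> V (c *: v) by move=> Vv; rewrite -[_ *: _]addr0; exact: VP.
pose S := [set nm (y - v) ^+ 2 | v in V].
have hS : has_inf S.
  split; first by exists (nm (y - 0) ^+ 2), 0.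
  by exists 0 => _ [v _ <-]; exact: sqr_ge0.
have dle v : V v -> inf S <= nm (y - v) ^+ 2.
  by move=> Vv; apply: ge_inf; [case: hS|exists v].
have /choice[u hu] : forall n : nat, exists v,
    V v /\ nm (y - v) ^+ 2 < inf S + (n.+1%:R^-1) ^+ 2.
  move=> n; have [|_ [v Vv <-] ?] := @inf_adherent _ S ((n.+1%:R^-1) ^+ 2) _ hS.
    by rewrite exprn_gt0// invr_gt0 ltr0n.
  by exists v.
have [|x hx] := @complete_rate 2 u.
  move=> n m; have [Vn hn] := hu n; have [Vm hm] := hu m.
  set a := n.+1%:R^-1 in hn *; set b := m.+1%:R^-1 in hm *.
  have a0 : 0 < a by rewrite invr_gt0 ltr0n.
  have b0 : 0 < b by rewrite invr_gt0 ltr0n.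
  have Vh : V ((2^-1)%:C *: (u n + u m)).
    by apply: VZ; rewrite -[u n]scale1r; exact: VP.
  have := dle _ Vh.
  have E : nm (y - (2^-1)%:C *: (u n + u m)) ^+ 2 =
      (nm (y - u n) ^+ 2 + nm (y - u m) ^+ 2) / 2 - nm (u n - u m) ^+ 2 / 4.
    by rewrite -!(rip_nm hip) !(ripDl, ripDr, ripNl, ripNr, ripZl, ripZr)
      ?(ripC ip _ y) ?(ripC ip (u m) (u n)); field.
  rewrite E => h; rewrite -ler_sqr ?nnegrE ?nm_ge0//; last first.
    by rewrite addr_ge0// mulr_ge0// ltW.
  have := mulr_gt0 a0 b0; nra.
suff -> : y = x.
  apply: clV => e e0; have [n hn] : exists n : nat, 2 *+ 2 / n.+1%:R < e.
    apply: contrapT => nex; have : e <= 0.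
      apply: (@le_small_eq0 _ _ (2 *+ 2)) => n; rewrite leNgt; apply/negP => ?.
      by apply: nex; exists n.
    by rewrite leNgt e0.
  by exists (u n); [case: (hu n)|rewrite nmB; exact: le_lt_trans (hx n) hn].
apply/eqP; rewrite -subr_eq0; apply/eqP; apply: trivV.
(* Compare y - u n with y - u n - a v for a = 1 / (n + 1): the first is within
   a^2 of the infimum, so <y - u n, v> is of order a. *)
have half v : V v -> rip ip v (y - x) <= 0.
  move=> Vv; apply: (@le_small_eq0 _ _ (1 + nm v ^+ 2 + 4 * nm v)) => n.
  have [Vn hn] := hu n; have := hx n; set a := n.+1%:R^-1 in hn *.
  have a0 : 0 < a by rewrite invr_gt0 ltr0n.
  move=> hxn.
  have h1 : inf S <= nm (y - u n - a%:C *: v) ^+ 2.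
    by rewrite -addrA -opprD; apply: dle; rewrite addrC; exact: VP.
  rewrite (nm_sqrB hip) nmZ (gtr0_norm a0) ripZr in h1.
  have h2 : rip ip v (u n - x) <= nm v * (a * 4).
    apply: (le_trans (rip_le hip _ _)); rewrite ler_wpM2l ?nm_ge0//.
    by apply: (le_trans hxn); rewrite mulrC; lra.
  have -> : y - x = (y - u n) + (u n - x) by rewrite addrA subrK.
  rewrite ripDr.
  have h3 : a * (2 * rip ip (y - u n) v) <= a * (a * (1 + nm v ^+ 2)) by nra.
  rewrite (ler_pM2l a0) in h3; rewrite (ripC ip v (y - u n)).
  have := sqr_ge0 (nm v); nra.
have z v : V v -> rip ip v (y - x) = 0.
  move=> Vv; apply/eqP; rewrite eq_le half//= -oppr_le0 -ripNl.
  by apply: half; rewrite -scaleN1r; exact: VZ.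
by move=> v Vv; apply: ip_eq0; apply: z => //; exact: VZ.
Qed.

End Completeness.

(** * Borel measures on the line *)

Section MeasuresOnTheLine.
Context {R : realType}.
Local Notation measR := {measure set (measurableTypeR R) -> \bar R}.
Implicit Types mu nu : measR.

(** Half-open intervals form a pi-system generating the Borel sets, and their
    measures are differences of values of the distribution function. *)
Lemma measure_eq_cdf mu nu :
  (forall l : R, mu `]-oo, l]%classic = nu `]-oo, l]%classic) ->
  (forall l : R, mu `]-oo, l]%classic < +oo)%E ->
  forall A, measurable A -> mu A = nu A.
Proof.
move=> munu fin.
have mitv (i : interval R) : measurable ([set` i] : set (measurableTypeR R)).
  exact: measurable_itv.
have E (a b : R) : mu `]a, b]%classic = nu `]a, b]%classic.
  have [ab|ba] := leP a b; last first.
    by rewrite set_itv_ge ?measure0// bnd_simp -leNgt ltW.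
  have -> : `]a, b]%classic = `]-oo, b]%classic `\` `]-oo, a]%classic.
    by rewrite -[RHS]setCK setCD setCitvl setUC -[LHS]setCK setCitv.
  have I : `]-oo, b]%classic `&` `]-oo, a]%classic = `]-oo, a]%classic.
    by rewrite setIidr//; exact: subset_itvl.
  rewrite !measureD//=; last by rewrite -munu; exact: fin.
  by have := munu a; have := munu b; rewrite I => -> ->.
move=> A mA.
apply: (@measure_unique _ _ (measurableTypeR R) (@ocitv R)
  (fun n : nat => `](- n%:R), n%:R]%classic) _ _ _ _ mu nu) => //.
- exact: ocitvI.
- by move=> n; exact: is_ocitv.
- apply/seteqP; split=> // x _.
  exists (Num.truncn `|x|).+1 => //=; rewrite in_itv/=.
  have h : `|x| < (Num.truncn `|x|).+1%:R by exact: truncnS_gt.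
  rewrite ltrNl (le_lt_trans _ h) ?ler_normr ?lexx ?orbT//=.
  by rewrite (le_trans _ (ltW h))// ler_norm.
- by move=> _ [[a b]] _ <-; exact: E.
- move=> n; apply: le_lt_trans (fin n%:R).
  by apply: le_measure; rewrite ?inE//; exact: subset_itvr.
Qed.

(* closes, by assumption, the measurability goals of the integrals below *)
Let meas_sqr : measurable_fun [set: measurableTypeR R] (fun l : R => (l ^+ 2)%:E).
Proof. by apply/measurable_EFinP; exact: measurable_funX. Qed.

(** In a finite measure space, [|l| <= 1 + l^2]. *)
Lemma integrable_id mu : (mu setT < +oo)%E -> (\int[mu]_l (l ^+ 2)%:E < +oo)%E ->
  mu.-integrable setT (@EFin R).
Proof.
move=> fin sq; apply/integrableP; split => //.
apply: (@le_lt_trans _ _ (\int[mu]_l (1 + (l ^+ 2)%:E))%E); last first.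
  rewrite ge0_integralD//; last by move=> x _; rewrite lee_fin sqr_ge0.
  by rewrite integral_cst// mul1e lte_add_pinfty.
apply: ge0_le_integral => //.
- exact: measurableT_comp.
- exact: emeasurable_funD.
- move=> x _; rewrite -EFinD lee_fin.
  by have := real_normK (num_real x); have := sqr_ge0 (`|x| - 1); nra.
Qed.

Section Additivity.
Variables mu nu1 nu2 : measR.
Hypothesis cdf_add : forall l : R,
  (mu `]-oo, l]%classic = nu1 `]-oo, l]%classic + nu2 `]-oo, l]%classic)%E.
Hypothesis fin : (mu setT < +oo)%E.

Let mu_eq A : measurable A -> mu A = measure_add nu1 nu2 A.
Proof.
apply: measure_eq_cdf => l; first by rewrite [RHS]measure_addE.
apply: le_lt_trans fin; apply: le_measure; rewrite ?inE//.
Qed.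

Lemma integral_sqr_add : (\int[mu]_l (l ^+ 2)%:E =
  \int[nu1]_l (l ^+ 2)%:E + \int[nu2]_l (l ^+ 2)%:E)%E.
Proof.
rewrite -ge0_integral_measure_add//; last by move=> x _; rewrite lee_fin sqr_ge0.
by apply: eq_measure_integral => A mA _; exact: mu_eq.
Qed.

Lemma Rintegral_id_add : nu1.-integrable setT (@EFin R) ->
  nu2.-integrable setT (@EFin R) ->
  (\int[mu]_l l = \int[nu1]_l l + \int[nu2]_l l)%R.
Proof.
move=> i1 i2; rewrite /Rintegral -fineD; last 2 first.
- exact: integrable_fin_num.
- exact: integrable_fin_num.
rewrite -integral_measure_add//; congr fine.
by apply: eq_measure_integral => A mA _; exact: mu_eq.
Qed.

End Additivity.

Let mitv (i : interval R) : measurable ([set` i] : set (measurableTypeR R)).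
Proof. exact: measurable_itv. Qed.

Let ray_fin mu (i : interval R) : (mu setT < +oo)%E -> (mu [set` i] < +oo)%E.
Proof. by apply: le_lt_trans; apply: le_measure; rewrite ?inE. Qed.

Lemma setT_rays (m : R) :
  setT = `]-oo, m]%classic `|` `]m, +oo[%classic :> set (measurableTypeR R).
Proof. by rewrite -setCitvr setUC setUv. Qed.

Lemma measure_rays mu (m : R) :
  mu setT = (mu `]-oo, m]%classic + mu `]m, +oo[%classic)%E.
Proof.
rewrite {1}(setT_rays m) measureU//.
by rewrite -setCitvr setICl.
Qed.

Lemma ray_null mu (m : R) : (mu setT < +oo)%E ->
  mu `]-oo, m]%classic = mu setT -> mu `]m, +oo[%classic = 0%E.
Proof.
move=> fin eT; have := measure_rays mu m; rewrite eT.
have : mu setT \is a fin_num by rewrite ge0_fin_numE.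
case: (mu setT) => // r _; case: (mu `]m, +oo[%classic) => //= q -[/eqP].
by rewrite -subr_eq0 opprD addrA subrr sub0r oppr_eq0 => /eqP ->.
Qed.

Let integrable_cst_ray mu (i : interval R) (m : R) : (mu setT < +oo)%E ->
  mu.-integrable ([set` i] : set (measurableTypeR R)) (EFin \o (fun=> m)).
Proof.
move=> fin; apply/integrableP; split; first exact: measurable_cst.
by rewrite (integral_cst _ (mitv i)) lte_mul_pinfty//; exact: ray_fin.
Qed.

Lemma Rintegral_id_le mu (m : R) : (mu setT < +oo)%E ->
  mu `]m, +oo[%classic = 0%E -> mu.-integrable setT (@EFin R) ->
  (\int[mu]_l l <= m * fine (mu setT))%R.
Proof.
move=> fin m0 i.
rewrite (measure_rays mu m) m0 adde0 /Rintegral.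
rewrite (negligible_integral (mitv `]m, +oo[) _ i)// setTD setCitvr.
rewrite -(Rintegral_cst _ (mitv `]-oo, m]) m).
apply: le_Rintegral => //.
- exact: (integrableS _ _ _ i).
- exact: integrable_cst_ray.
Qed.

Lemma Rintegral_id_ge mu (m : R) : (mu setT < +oo)%E ->
  mu `]-oo, m]%classic = 0%E -> mu.-integrable setT (@EFin R) ->
  (m * fine (mu setT) <= \int[mu]_l l)%R.
Proof.
move=> fin m0 i.
rewrite (measure_rays mu m) m0 add0e /Rintegral.
rewrite (negligible_integral (mitv `]-oo, m]) _ i)// setTD setCitvl.
rewrite -(Rintegral_cst _ (mitv `]m, +oo[) m).
apply: le_Rintegral => //.
- exact: integrable_cst_ray.
- exact: (integrableS _ _ _ i).
- by move=> x /=; rewrite in_itv/= andbT => /ltW.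
Qed.

Lemma integral_sqr_fin mu (l m : R) : (mu setT < +oo)%E ->
  mu `]-oo, l]%classic = 0%E -> mu `]m, +oo[%classic = 0%E ->
  (\int[mu]_l (l ^+ 2)%:E < +oo)%E.
Proof.
move=> fin l0 m0.
have sq0 (D : set (measurableTypeR R)) x : D x -> (0 <= ((x : R) ^+ 2)%:E)%E.
  by move=> _; rewrite lee_fin sqr_ge0.
rewrite (ge0_negligible_integral (mitv `]-oo, l]))//; last exact: sq0.
rewrite setTD setCitvl.
rewrite (ge0_negligible_integral (mitv `]m, +oo[))//;
  [|exact: measurable_funTS|exact: sq0].
have mD : measurable (`]l, +oo[%classic `\` `]m, +oo[%classic :
  set (measurableTypeR R)) by exact: measurableD.
apply: (@le_lt_trans _ _ (\int[mu]_(x in `]l, +oo[%classic `\` `]m, +oo[%classic)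
    (l ^+ 2 + m ^+ 2)%:E)%E); last first.
  rewrite integral_cst// lte_mul_pinfty// ?lee_fin ?addr_ge0 ?sqr_ge0//.
  by apply: le_lt_trans fin; apply: le_measure; rewrite ?inE.
apply: ge0_le_integral => //.
- by move=> x; exact: sq0.
- exact: measurable_funTS.
- move=> x [/=]; rewrite !in_itv/= !andbT => lx /negP; rewrite -leNgt => xm.
  rewrite lee_fin; have := sqr_ge0 l; have := sqr_ge0 m.
  by have [?|?] := lerP 0 (x : R); nra.
Qed.

End MeasuresOnTheLine.

(** * Calculus of a spectral family *)

Section SpectralFamily.
Context {R : realType} {H : completeNormedModType R[i]}.
Variable ip : {dot H for (@Num.conj R[i])}.
Hypothesis hip : hilbert_product ip.
Variables (T : operator H) (E : R -> H -> H).
Hypothesis saT : self_adjoint ip T.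
Hypothesis hE : spectral_family ip T E.

Local Notation rip := (rip ip).

Lemma dom_lin c x y : op_dom T x -> op_dom T y -> op_dom T (c *: x + y).
Proof. by case: saT => [[_ L] _ _] dx dy; case: (L c x y dx dy). Qed.

Lemma op_lin c x y : op_dom T x -> op_dom T y -> T (c *: x + y) = c *: T x + T y.
Proof. by case: saT => [[_ L] _ _] dx dy; case: (L c x y dx dy). Qed.

Lemma dom0 : op_dom T 0.
Proof. by case: saT => [[]]. Qed.

Lemma op0 : T 0 = 0.
Proof.
have := op_lin 1 dom0 dom0; rewrite !scale1r addr0 => /eqP.
by rewrite -subr_eq0 opprD addrA subrr sub0r oppr_eq0 => /eqP.
Qed.

Lemma domZ c x : op_dom T x -> op_dom T (c *: x).
Proof. by move=> dx; rewrite -[_ *: _]addr0; exact: dom_lin dom0. Qed.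

Lemma opZ c x : op_dom T x -> T (c *: x) = c *: T x.
Proof.
by move=> dx; rewrite -[c *: x]addr0 op_lin// ?op0 ?addr0//; exact: dom0.
Qed.

Lemma domD x y : op_dom T x -> op_dom T y -> op_dom T (x + y).
Proof. by move=> dx dy; rewrite -[x]scale1r; exact: dom_lin. Qed.

Lemma opD x y : op_dom T x -> op_dom T y -> T (x + y) = T x + T y.
Proof. by move=> dx dy; rewrite -{1}[x]scale1r op_lin// scale1r. Qed.

Lemma domN x : op_dom T x -> op_dom T (- x).
Proof. by move=> dx; rewrite -scaleN1r; exact: domZ. Qed.

Lemma opN x : op_dom T x -> T (- x) = - T x.
Proof. by move=> dx; rewrite -scaleN1r opZ// scaleN1r. Qed.

Lemma domB x y : op_dom T x -> op_dom T y -> op_dom T (x - y).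
Proof. by move=> dx dy; apply: domD => //; exact: domN. Qed.

Lemma opB x y : op_dom T x -> op_dom T y -> T (x - y) = T x - T y.
Proof. by move=> dx dy; rewrite opD ?opN//; exact: domN. Qed.

Lemma op_sym x y : op_dom T x -> op_dom T y -> ip (T x) y = ip x (T y).
Proof.
move=> dx dy; case: saT => _ _ /(_ y (T y))[_ /(_ (conj dy erefl))]; exact.
Qed.

Lemma op_adj y z : (forall x, op_dom T x -> ip (T x) y = ip x z) ->
  op_dom T y /\ T y = z.
Proof. by move=> h; case: saT => _ _ /(_ y z)[+ _]; exact. Qed.

Lemma rip_op_sym x y : op_dom T x -> op_dom T y -> rip (T x) y = rip x (T y).
Proof. by move=> dx dy; rewrite /rip op_sym. Qed.

Let pE l := spectral_family_proj hE l.

Lemma specD l x y : E l (x + y) = E l x + E l y.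
Proof. by have [] := projP (pE l). Qed.
Lemma specN l x : E l (- x) = - E l x.
Proof. by have [] := projP (pE l). Qed.
Lemma specB l x y : E l (x - y) = E l x - E l y.
Proof. by rewrite specD specN. Qed.
Lemma specZ l c x : E l (c *: x) = c *: E l x.
Proof. by have [] := projP (pE l). Qed.
Lemma spec0 l : E l 0 = 0.
Proof. by have [] := projP (pE l). Qed.
Lemma spec_idem l x : E l (E l x) = E l x.
Proof. by have [] := pE l. Qed.
Lemma spec_sym l x y : ip (E l x) y = ip x (E l y).
Proof. by have [] := pE l. Qed.
Lemma spec_rsym l x y : rip (E l x) y = rip x (E l y).
Proof. by rewrite /rip spec_sym. Qed.
Lemma spec_compl l x : E l (x - E l x) = 0.
Proof. by rewrite specB spec_idem subrr. Qed.

Lemma ip_ext (x y : H) : (forall z, ip z x = ip z y) -> x = y.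
Proof.
move=> h; apply/eqP; rewrite -subr_eq0 -(dnorm_eq0 ip).
by rewrite ipDr h -ipDr subrr ip0r.
Qed.

Lemma spec_low l m x : l <= m -> E l (E m x) = E l x.
Proof. exact: (spectral_family_mono hE). Qed.

(** Monotonicity is assumed for products in one order only; the other order is
    its adjoint. *)
Lemma spec_up l m x : l <= m -> E m (E l x) = E l x.
Proof.
move=> lm; apply: ip_ext => z.
by rewrite -spec_sym -spec_sym spec_low// spec_sym.
Qed.

Lemma spec_comm l m x : E l (E m x) = E m (E l x).
Proof.
have [lm|/ltW ml] := leP l m; first by rewrite spec_low// spec_up.
by rewrite spec_up// spec_low.
Qed.

Lemma spec_up_id l m x : l <= m -> E l x = x -> E m x = x.
Proof. by move=> lm <-; exact: spec_up. Qed.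

Lemma spec_low0 l m x : l <= m -> E m x = 0 -> E l x = 0.
Proof. by move=> lm mx; rewrite -(spec_low _ lm) mx spec0. Qed.

Lemma spec_orth l u w : E l u = u -> E l w = 0 -> ip u w = 0.
Proof. by move=> <- w0; rewrite spec_sym w0 ip0r. Qed.

Lemma spec_rorth l u w : E l u = u -> E l w = 0 -> rip u w = 0.
Proof. by move=> hu hw; rewrite /rip (spec_orth hu hw). Qed.

Lemma spec_pythag l u w : E l u = u -> E l w = 0 ->
  nm (u + w) ^+ 2 = nm u ^+ 2 + nm w ^+ 2.
Proof. by move=> hu hw; rewrite (pythag hip)//; exact: spec_rorth hw. Qed.

(** The total mass of the measure attached to [x] is the limit of [|E n x|^2],
    which is [|x|^2] because [E n x] tends to [x]. *)
Lemma spec_measure x :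
  exists mu : {measure set (measurableTypeR R) -> \bar R},
    [/\ forall l : R, mu `]-oo, l]%classic = (nm (E l x) ^+ 2)%:E,
        mu setT = (nm x ^+ 2)%:E,
        op_dom T x <-> (\int[mu]_l (l ^+ 2)%:E < +oo)%E &
        op_dom T x -> rip (T x) x = (\int[mu]_l l)%R].
Proof.
have [mu [cdf domP form]] := spectral_family_integral hE x.
have mul (l : R) : mu `]-oo, l]%classic = (nm (E l x) ^+ 2)%:E.
  have [h fin] := cdf l.
  rewrite -(rip_nm hip) -(spec_rsym _ (E l x)) spec_idem /rip h/= fineK//.
  by rewrite ge0_fin_numE.
exists mu; split => //; last by move=> dx; rewrite /rip form.
pose F (n : nat) : set (measurableTypeR R) := `]-oo, n%:R]%classic.
have FT : \bigcup_n F n = setT.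
  apply/seteqP; split=> // y _; exists (Num.truncn `|y|).+1 => //=.
  rewrite /F/= in_itv/=.
  by apply: (le_trans (ler_norm _)); apply: ltW; exact: truncnS_gt.
have c1 : (mu \o F) n @[n --> \oo] --> mu setT.
  rewrite -FT; apply: nondecreasing_cvg_mu.
  - by move=> n; exact: measurable_itv.
  - by rewrite FT.
  - move=> n m nm; apply/subsetPset; apply: subset_itvl.
    by rewrite bnd_simp ler_nat.
have c2 : (mu \o F) n @[n --> \oo] --> (nm x ^+ 2)%:E.
  rewrite (_ : mu \o F = EFin \o (fun n : nat => nm (E n%:R x) ^+ 2)); last first.
    by apply/funext => n /=; rewrite mul.
  apply: cvg_EFin; first exact: nearW.
  apply/cvgrPdist_lt => e e0.
  have h := @spectral_family_pinfty _ _ _ _ _ hE x.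
  have /cvg_nm h2 := cvg_comp _ _ (@cvgr_idn R) h.
  have /= := h2 (Num.min 1 e); rewrite lt_min ltr01 e0 => /(_ isT).
  apply: filterS => n; rewrite lt_min => /andP[n1 ne].
  have -> : nm x ^+ 2 - nm (E n%:R x) ^+ 2 = nm (x - E n%:R x) ^+ 2.
    have := spec_pythag (spec_idem n%:R x) (spec_compl n%:R x).
    by rewrite [E _ _ + _]addrC subrK => ->; rewrite addrC addKr.
  rewrite ger0_norm ?sqr_ge0//; have := nm_ge0 (x - E n%:R x).
  by nra.
exact: (cvg_unique _ c1 c2).
Qed.

(** The distribution function of the measure of [u + w] is the sum of those of
    [u] and [w], since the components [E k u] and [E k w] are orthogonal; hence
    the integrals defining the domain and the form of [T] add up. *)
Lemma split_dom_form l u w : E l u = u -> E l w = 0 ->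
  (op_dom T (u + w) <-> op_dom T u /\ op_dom T w) /\
  (op_dom T u -> op_dom T w ->
   rip (T (u + w)) (u + w) = rip (T u) u + rip (T w) w).
Proof.
move=> hu hw.
have [mu [mul muT domx formx]] := spec_measure (u + w).
have [nu1 [nu1l nu1T domu formu]] := spec_measure u.
have [nu2 [nu2l nu2T domw formw]] := spec_measure w.
have cdf_add k :
    (mu `]-oo, k]%classic = nu1 `]-oo, k]%classic + nu2 `]-oo, k]%classic)%E.
  rewrite mul nu1l nu2l specD -EFinD (@spec_pythag l)//.
    by rewrite spec_comm hu.
  by rewrite spec_comm hw spec0.
have muF : (mu setT < +oo)%E by rewrite muT ltry.
have nu1F : (nu1 setT < +oo)%E by rewrite nu1T ltry.
have nu2F : (nu2 setT < +oo)%E by rewrite nu2T ltry.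
have sq := integral_sqr_add cdf_add muF.
have sq_ge0 (nu : {measure set (measurableTypeR R) -> \bar R}) :
    (0 <= \int[nu]_l (l ^+ 2)%:E)%E.
  by apply: integral_ge0 => x _; rewrite lee_fin sqr_ge0.
have D : op_dom T (u + w) <-> op_dom T u /\ op_dom T w.
  rewrite domx domu domw sq; split; last by case=> ? ?; exact: lte_add_pinfty.
  move=> h; split; apply: le_lt_trans h.
    by rewrite leeDl.
  by rewrite leeDr.
split => // du dw; rewrite formx; last by apply/D.
rewrite formu// formw//; apply: Rintegral_id_add => //.
  by apply: integrable_id => //; exact/domu.
by apply: integrable_id => //; exact/domw.
Qed.

Lemma spec_dom l x : op_dom T x -> op_dom T (E l x).
Proof.
have [h _] := split_dom_form (spec_idem l x) (spec_compl l x).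
by rewrite -{1}(subrK (E l x) x) addrC => /h[].
Qed.

(** The form of [T] has no cross term between [u] and [w], which makes the real
    part of [<T u, w>] vanish by symmetry; [i u] takes care of the imaginary
    part. *)
Lemma spec_form_orth l u w : op_dom T u -> op_dom T w ->
  E l u = u -> E l w = 0 -> ip (T u) w = 0.
Proof.
move=> du dw hu hw.
have orth v : op_dom T v -> E l v = v -> rip (T v) w = 0.
  move=> dv hv; have [_ /(_ dv dw)] := split_dom_form hv hw.
  rewrite opD// !(ripDl, ripDr) (rip_op_sym dw dv) (ripC ip w (T v)); lra.
apply: ip_eq0; first exact: orth.
rewrite -opZ//; apply: orth; first exact: domZ.
by rewrite specZ hu.
Qed.

(** The absence of cross terms shows that [E l (T (E l x))] is a value at [E l x]
    of the adjoint of [T], which is [T] itself; likewise on the range of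
    [1 - E l]. *)
Lemma spec_op l x : op_dom T x -> T (E l x) = E l (T x).
Proof.
move=> dx; set u := E l x; set w := x - u.
have du : op_dom T u by exact: spec_dom.
have dw : op_dom T w by exact: domB.
have hu : E l u = u by exact: spec_idem.
have hw : E l w = 0 by exact: spec_compl.
have [_ Tu] : op_dom T u /\ T u = E l (T u).
  apply: op_adj => v dv; rewrite op_sym//.
  have dv1 := spec_dom l dv; have dv2 := domB dv dv1.
  rewrite -spec_sym -[in LHS](subrK (E l v) v) ipDl.
  rewrite [ip (v - _) _]ipC (spec_form_orth du dv2 hu) ?spec_compl//.
  by rewrite conjC0 add0r.
have [_ Tw] : op_dom T w /\ T w = T w - E l (T w).
  apply: op_adj => v dv; rewrite op_sym// ipDr.
  have dv1 := spec_dom l dv; have dv2 := domB dv dv1.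
  have -> : ip v (- E l (T w)) = - ip (E l v) (T w).
    by rewrite spec_sym ipNr.
  rewrite -(op_sym dv1 dw) (spec_form_orth dv1 dw (l:=l)) ?spec_idem//.
  by rewrite oppr0 addr0.
have Ew : E l (T w) = 0 by rewrite Tw spec_compl.
have -> : T x = T u + T w by rewrite -opD// addrC subrK.
by rewrite specD Ew addr0.
Qed.

(** The measure of a vector in the range of [E l] is carried by the ray up to
    [l]. *)
Lemma form_le l x : op_dom T x -> E l x = x -> rip (T x) x <= l * nm x ^+ 2.
Proof.
move=> dx hx; have [mu [mul muT domx formx]] := spec_measure x.
have muF : (mu setT < +oo)%E by rewrite muT ltry.
have m0 : mu `]l, +oo[%classic = 0%E.
  by apply: ray_null => //; rewrite mul hx.
rewrite formx//; have := Rintegral_id_le muF m0.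
by rewrite muT; apply; apply: integrable_id => //; exact/domx.
Qed.

(** The measure of a vector in the kernel of [E l] is carried by the open ray
    above [l]. *)
Lemma form_ge l x : op_dom T x -> E l x = 0 -> l * nm x ^+ 2 <= rip (T x) x.
Proof.
move=> dx hx; have [mu [mul muT domx formx]] := spec_measure x.
have muF : (mu setT < +oo)%E by rewrite muT ltry.
have m0 : mu `]-oo, l]%classic = 0%E by rewrite mul hx nm0 expr0n.
rewrite formx//; have := Rintegral_id_ge muF m0.
by rewrite muT; apply; apply: integrable_id => //; exact/domx.
Qed.

(** The measure of [x] has bounded support, so it has a finite second moment. *)
Lemma band_dom l m x : E m x = x -> E l x = 0 -> op_dom T x.
Proof.
move=> hm hl; have [mu [mul muT domx formx]] := spec_measure x.
have muF : (mu setT < +oo)%E by rewrite muT ltry.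
apply/domx; apply: (@integral_sqr_fin _ mu l m) => //.
  by rewrite mul hl nm0 expr0n.
by apply: ray_null => //; rewrite mul hm.
Qed.

(** On the band, [S = T - c] is symmetric with form bounded by [r].  Polarization
    applied to [x] and [r^-1 S x] passes from the form to the norm. *)
Lemma band_norm_le l m c r x : 0 < r -> c - r <= l -> m <= c + r ->
  E m x = x -> E l x = 0 -> nm (T x - c%:C *: x) <= r * nm x.
Proof.
move=> r0 cl cm hm hl.
pose S y := T y - c%:C *: y.
have Sband y : E m y = y -> E l y = 0 -> E m (S y) = S y /\ E l (S y) = 0.
  move=> my ly; have dy := band_dom my ly.
  by rewrite /S !specB !specZ -!spec_op// my ly op0 scaler0 subrr.
have form y : E m y = y -> E l y = 0 -> `|rip (S y) y| <= r * nm y ^+ 2.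
  move=> my ly; have dy := band_dom my ly.
  have h1 := form_le dy my; have h2 := form_ge dy ly.
  have := sqr_ge0 (nm y); rewrite /S ripBl ripZl (rip_nm hip) ler_norml => ?.
  by apply/andP; split; nra.
have [mS lS] := Sband x hm hl.
have dx := band_dom hm hl; have dS := band_dom mS lS.
(* the factor r^-1 balances the two terms of the polarized inequality *)
have [y yE] : exists y, y = r^-1%:C *: S x by exists (r^-1%:C *: S x).
have my : E m y = y by rewrite yE specZ mS.
have ly : E l y = 0 by rewrite yE specZ lS scaler0.
have dy := band_dom my ly.
have h1 := form (x + y); have h2 := form (x - y).
rewrite !(specD, specN) hm my hl ly addr0 in h1.
rewrite !(specD, specN) hm my hl ly subr0 in h2.
have SD u v : op_dom T u -> op_dom T v -> S (u + v) = S u + S v.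
  by move=> du dv; rewrite /S opD// scalerDr opprD addrACA.
have SN u : op_dom T u -> S (- u) = - S u.
  by move=> du; rewrite /S opN// scalerN opprK opprB addrC.
have Ssym : rip (S y) x = rip (S x) y.
  rewrite /S !ripBl !ripZl (rip_op_sym dy dx) (ripC ip y) (ripC ip y x).
  by [].
have dNy := domN dy.
rewrite -/(S x); clearbody S.
have := h1 erefl erefl; have := h2 erefl erefl.
rewrite !(SD _ _ dx)// SN// !(ripDl, ripNl, ripDr, ripNr) Ssym.
rewrite !(nm_sqrD hip, nmN, ripNr) => k1 k2.
have k : rip (S x) y *+ 4 <= r * (nm x ^+ 2 + nm y ^+ 2) *+ 2.
  move: k1 k2; rewrite !ler_norml => /andP[k1 _] /andP[_ k2].
  by rewrite !mulr2n in k1 k2 *; rewrite -[4%N]/(2 + 2)%N mulrnDr !mulr2n; lra.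
rewrite yE ripZr (rip_nm hip) nmZ gtr0_norm ?invr_gt0// in k.
rewrite -ler_sqr ?nnegrE ?nm_ge0//; last by rewrite mulr_ge0 ?nm_ge0// ltW.
set s := nm (S x) in k *.
set q := r^-1 * s in k; have sE : s = r * q by rewrite mulVKf// gt_eqF.
have e : r^-1 * s ^+ 2 = r * q ^+ 2.
  by rewrite sE exprMn expr2 -mulrA mulKf// gt_eqF.
rewrite e -[4%N]/(2 * 2)%N mulrnA ler_pMn2r// -mulrnAr ler_pM2l// in k.
clearbody q; rewrite sE !exprMn ler_wpM2l ?sqr_ge0//; move: k; rewrite mulr2n; lra.
Qed.

End SpectralFamily.

(** * Resolvents of self-adjoint operators *)

Section Operators.
Context {R : realType} {H : completeNormedModType R[i]}.

Lemma continuous_bounded (S : {linear H -> H}) : continuous S ->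
  exists2 M : R, 0 < M & forall x, nm (S x) <= M * nm x.
Proof.
move=> /linear_bounded_continuous /linear_boundedP /pinfty_ex_gt0[M M0 h].
have ME : M = (complex.Re M)%:C by rewrite RRe_real// gtr0_real.
rewrite ME in M0 h; rewrite ltcR in M0; exists (complex.Re M) => // x.
by have := h x; rewrite !normE -rmorphM/= lecR.
Qed.

Lemma bounded_continuous (S : {linear H -> H}) (M : R) :
  (forall x, nm (S x) <= M * nm x) -> continuous S.
Proof.
move=> h; apply/linear_bounded_continuous/linear_boundedP.
exists M%:C; split; first by apply/complex_realP; exists M.
move=> r Mr x; have rE : r = (complex.Re r)%:C.
  by case: r Mr => u v; rewrite ltcE/= => /andP[/eqP ->].
rewrite rE ltcR in Mr; rewrite rE !normE -rmorphM/= lecR.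
by apply: (le_trans (h x)); rewrite ler_wpM2r ?nm_ge0// ltW.
Qed.

Variable ip : {dot H for (@Num.conj R[i])}.
Hypothesis hip : hilbert_product ip.
Variable T : operator H.
Hypothesis saT : self_adjoint ip T.

Local Notation rip := (rip ip).

(** The range of [T - z] is closed because [T] is closed and [T - z] is bounded
    below, and its orthogonal complement is the kernel of [T - z^*], which is
    trivial; so [T - z] is onto. *)
Lemma bounded_below_resolvent (z : R[i]) (k : R) : 0 < k ->
  (forall x, op_dom T x -> k * nm x <= nm (T x - z *: x)) ->
  (forall x, op_dom T x -> k * nm x <= nm (T x - Num.conj z *: x)) ->
  resolvent_set T z.
Proof.
move=> k0 lbz lbcz.
pose U x := T x - z *: x.
have UP c x y : op_dom T x -> op_dom T y -> U (c *: x + y) = c *: U x + U y.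
  move=> dx dy; rewrite /U (op_lin saT)// scalerDr opprD addrACA scalerBr.
  by rewrite !scalerA (mulrC z).
have dP c x y : op_dom T x -> op_dom T y -> op_dom T (c *: x + y).
  exact: dom_lin saT _ _ _.
have UB x y : op_dom T x -> op_dom T y -> U (x - y) = U x - U y.
  by move=> dx dy; rewrite -[x - y]addrC -scaleN1r UP// scaleN1r addrC.
have dB := domB saT.
pose V : set H := [set U x | x in op_dom T].
have surj : forall y, V y.
  apply: (projection_theorem hip).
  - split; first by exists 0; [exact: dom0 saT|rewrite /U (op0 saT) scaler0 subr0].
    by move=> c _ _ [x dx <-] [y dy <-]; exists (c *: x + y); [exact: dP|exact: UP].
  - move=> y ycl.
    have /choice[x hx] : forall n : nat, exists x,
        op_dom T x /\ nm (y - U x) <= k / n.+1%:R.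
      move=> n; have [|_ [x dx <-] h] := ycl (k / n.+1%:R).
        by rewrite divr_gt0// ltr0n.
      by exists x; split=> //; exact: ltW.
    have [|x0 hx0] := @complete_rate _ _ 1 x.
      move=> n m; have [dn hn] := hx n; have [dm hm] := hx m.
      rewrite -(ler_pM2l k0); apply: (le_trans (lbz _ (dB _ _ dn dm))).
      rewrite -/(U _) UB// (_ : U (x n) - U (x m) = (y - U (x m)) - (y - U (x n))).
        apply: (le_trans (nmD _ _)); rewrite nmN addrC mulrDr !mul1r.
        exact: lerD.
      have dd (u v w : H) : w - v = (u - v) - (u - w).
        by rewrite opprB [RHS]addrC addrA subrK.
      exact: dd.
    (* x0 is in the domain of the adjoint: pass to the limit n -> oo in
       <T v, x n> = <v, T (x n)>, with error terms of order 1 / (n + 1). *)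
    have key v : op_dom T v -> rip (T v) x0 - rip v (y + z *: x0) <= 0.
      move=> dv; apply: (@le_small_eq0 _ _
        (nm (T v) * 2 + nm v * k + nm v * (complex.Re `|z| * 2))) => n.
      have [dn hn] := hx n; have h0 := hx0 n.
      have -> : rip (T v) x0 - rip v (y + z *: x0) =
          rip (T v) (x0 - x n) + rip v (U (x n) - y) + rip v (z *: (x n - x0)).
        rewrite /U scalerBr !(ripDr, ripNr) (rip_op_sym saT dv dn); ring.
      rewrite !mulrDl; apply: lerD; first apply: lerD.
      + apply: (le_trans (rip_le hip _ _)); rewrite -mulrA ler_wpM2l ?nm_ge0//.
        by rewrite nmB; move: h0; rewrite mulr2n.
      + apply: (le_trans (rip_le hip _ _)); rewrite -mulrA ler_wpM2l ?nm_ge0//.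
        by rewrite nmB.
      + apply: (le_trans (rip_le hip _ _)); rewrite -!mulrA ler_wpM2l ?nm_ge0//.
        rewrite nmZC ler_wpM2l//.
        by have := normr_ge0 z; rewrite lecE/= => /andP[].
    have key0 v : op_dom T v -> rip (T v) x0 - rip v (y + z *: x0) = 0.
      move=> dv; apply/eqP; rewrite eq_le key//= -oppr_le0.
      have := key _ (domN saT dv); rewrite (opN saT)// !ripNl; lra.
    have [d0 T0] : op_dom T x0 /\ T x0 = y + z *: x0.
      apply: (op_adj saT) => v dv; apply/eqP; rewrite -subr_eq0.
      pose g := ip (T v) x0 - ip v (y + z *: x0).
      have g1 : complex.Re g = 0 by rewrite /g ReD ReN; exact: key0.
      have g2 : complex.Re ('i%C * g) = 0.
        have := key0 _ (domZ saT 'i%C dv).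
        by rewrite (opZ saT)// /rip !ipZl /g mulrBr ReD ReN.
      rewrite -/g; case: g g1 g2 => a b /= ->; rewrite mul0r mul1r sub0r => /eqP.
      by rewrite oppr_eq0 => /eqP ->.
    by exists x0 => //; rewrite /U T0 addrK.
  - move=> y yV.
    have [dy Ty] : op_dom T y /\ T y = Num.conj z *: y.
      apply: (op_adj saT) => x dx; have /= := yV (U x) (ex_intro2 _ _ x dx erefl).
      rewrite /U ipDl ipNl ipZl => /eqP; rewrite subr_eq0 => /eqP ->.
      by rewrite ipZr conjCK.
    apply/eqP; rewrite -nm_eq0 eq_le nm_ge0 andbT -(pmulr_rle0 _ k0).
    by have := lbcz y dy; rewrite Ty subrr nm0.
have /choice[S hS] : forall y, exists x, op_dom T x /\ U x = y.
  by move=> y; have [x dx <-] := surj y; exists x.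
have inj x y : op_dom T x -> op_dom T y -> U x = U y -> x = y.
  move=> dx dy e; apply/eqP; rewrite -subr_eq0 -nm_eq0 eq_le nm_ge0 andbT.
  rewrite -(pmulr_rle0 _ k0); have := lbz _ (dB _ _ dx dy).
  by rewrite -/(U _) UB// e subrr nm0.
have linS : linear S.
  move=> c x y; have [dx ex] := hS x; have [dy ey] := hS y.
  have [d e] := hS (c *: x + y); apply: inj => //; first exact: dP.
  by rewrite UP// ex ey.
pose Sl : {linear H -> H} := HB.pack S (GRing.isLinear.Build _ _ _ _ S linS).
exists Sl; split.
- apply: (@bounded_continuous Sl k^-1) => x /=.
  have [dx ex] := hS x; have := lbz _ dx; rewrite -/(U _) ex => h.
  by rewrite -(ler_pM2l k0) mulVKf// gt_eqF.
- by move=> y; exact: hS.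
- move=> x dx /=; have [d e] := hS (U x); exact: inj.
Qed.

End Operators.

(** * Spectral bands and the essential spectrum *)

Section Bands.
Context {R : realType} {H : completeNormedModType R[i]}.

(** For [l <= m], the range of the spectral projection of the interval (l, m]: by
    [band_diff] and [band_diff_id] it is the range of [E m - E l]. *)
Definition band (E : R -> H -> H) (l m : R) : set H :=
  [set x | E m x = x /\ E l x = 0].

(** The form in which the perturbation arguments use the essential spectrum: by
    [ess_point_spectrum] and [ess_spectrum_point] it is the same notion for a
    self-adjoint operator with spectral family [E]. *)
Definition ess_point (E : R -> H -> H) (c : R) : Prop :=
  forall d : R, 0 < d -> ~ finite_dim (band E (c - d) (c + d)).

Variable ip : {dot H for (@Num.conj R[i])}.
Hypothesis hip : hilbert_product ip.
Variables (T : operator H) (E : R -> H -> H).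
Hypothesis saT : self_adjoint ip T.
Hypothesis hE : spectral_family ip T E.

Lemma band_subspace l m : lin_subspace (band E l m).
Proof.
split; first by split; rewrite (spec0 hE).
move=> c x y [mx lx] [my ly].
by split; rewrite (specD hE) (specZ hE) ?mx ?my ?lx ?ly ?scaler0 ?addr0.
Qed.

Lemma sub_band l m l' m' : l <= l' -> m' <= m -> band E l' m' `<=` band E l m.
Proof.
move=> ll mm x [mx lx]; split; first exact: (spec_up_id hE mm mx).
exact: (spec_low0 hE ll).
Qed.

Lemma band_diff l m x : l <= m -> band E l m (E m x - E l x).
Proof.
move=> lm; split; rewrite (specB hE) (spec_idem hE).
  by rewrite (spec_up hE).
by rewrite (spec_low hE)// subrr.
Qed.

Lemma band_diff_id l m x : band E l m x -> E m x - E l x = x.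
Proof. by move=> [-> ->]; rewrite subr0. Qed.

Lemma diff_proj l m : l <= m -> orth_projection ip (fun x => E m x - E l x).
Proof.
move=> lm; split.
- move=> c x y; rewrite !(specD hE) !(specZ hE) scalerBr opprD.
  by rewrite addrACA.
- by move=> x; exact: (band_diff_id (band_diff x lm)).
- move=> x y; by rewrite ipDl ipDr ipNl ipNr !(spec_sym hE).
Qed.

Lemma band_split l m k x : l <= m -> m <= k -> band E l k x ->
  band E l m (E m x) /\ band E m k (x - E m x).
Proof.
move=> lm mk [kx lx]; split; split.
- exact: spec_idem hE _ _.
- by rewrite (spec_low hE).
- by rewrite (specB hE) kx (spec_up hE).
- exact: spec_compl hE _ _.
Qed.

Lemma exists_off_band (V : set H) l m : lin_subspace V -> ~ finite_dim V ->
  l <= m -> finite_dim (band E l m) -> exists x, [/\ V x, x != 0 & E m x = E l x].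
Proof.
move=> sV iV lm fin.
have [|x [Vx x0 /eqP]] := exists_in_kernel sV iV (diff_proj lm).
  by apply: finite_dim_sub fin => _ [x _ <-]; exact: band_diff.
by rewrite subr_eq0 => /eqP ?; exists x.
Qed.

Lemma finite_band_cat l m k : l <= m -> m <= k ->
  finite_dim (band E l m) -> finite_dim (band E m k) -> finite_dim (band E l k).
Proof.
move=> lm mk f1 f2; apply: (finite_dim_add f1 f2) => x bx.
have [b1 b2] := band_split lm mk bx.
by exists (E m x), (x - E m x); split=> //; rewrite addrC subrK.
Qed.

Lemma not_ess_point c : ~ ess_point E c ->
  exists2 d, 0 < d & finite_dim (band E (c - d) (c + d)).
Proof.
move=> /existsNP[d /not_implyP[d0 /contrapT f]]; by exists d.
Qed.

Lemma gap_finite l m : l <= m -> (forall c, l <= c <= m -> ~ ess_point E c) ->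
  finite_dim (band E l m).
Proof.
move=> lm h; apply: (@local_to_global R (fun l m => finite_dim (band E l m))) => //.
- by move=> x y x' y' xx _ yy; apply: finite_dim_sub; exact: sub_band.
- exact: finite_band_cat.
- by move=> c cI; exact: not_ess_point (h _ cI).
Qed.

Lemma band_trivial_cat l m k : l <= m -> m <= k ->
  (forall x, band E l m x -> x = 0) -> (forall x, band E m k x -> x = 0) ->
  forall x, band E l k x -> x = 0.
Proof.
move=> lm mk f1 f2 x bx; have [/f1 b1 /f2] := band_split lm mk bx.
by rewrite b1 subr0.
Qed.

(** On the band of radius [e] the operator is within [e] of [c]. *)
Lemma eigen_of_bands c d x : 0 < d ->
  (forall e, 0 < e -> e <= d -> band E (c - e) (c + e) x) ->
  op_dom T x /\ T x = c%:C *: x.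
Proof.
move=> d0 h; have bd := h d d0 (lexx d).
split; first by case: bd => b1 b2; exact: (band_dom hip hE b1 b2).
apply/eqP; rewrite -subr_eq0 -nm_eq0 eq_le nm_ge0 andbT.
apply: (@le_small_eq0 _ _ (d * nm x)) => n.
have n0 : 0 < d / n.+1%:R by rewrite divr_gt0// ltr0n.
have [||b1 b2] := h (d / n.+1%:R) => //.
  by rewrite ler_pdivrMr ?ltr0n// ler_peMr ?ler1n// ltW.
rewrite mulrAC.
exact: (band_norm_le hip saT hE n0 (lexx _) (lexx _) b1 b2).
Qed.

(** An inverse of [T - c] bounded by [M] leaves no room for a nonzero vector
    on which [T - c] is smaller than [1 / (2 M)]. *)
Lemma resolvent_trivial_band c : resolvent_set T c%:C ->
  exists2 d, 0 < d & forall x, band E (c - d) (c + d) x -> x = 0.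
Proof.
move=> [S [cS _ hS]]; have [M M0 hM] := continuous_bounded cS.
have d0 : 0 < (M *+ 2)^-1 by rewrite invr_gt0 mulrn_wgt0.
exists (M *+ 2)^-1 => // x [b1 b2].
have dx := band_dom hip hE b1 b2.
have h := band_norm_le hip saT hE d0 (lexx _) (lexx _) b1 b2.
have := hM (T x - c%:C *: x); rewrite hS// => h2.
apply/eqP; rewrite -nm_eq0 eq_le nm_ge0 andbT.
have h3 := le_trans h2 (ler_wpM2l (ltW M0) h).
have e : M * ((M *+ 2)^-1 * nm x) = nm x / 2.
  by rewrite -mulr_natl; field; rewrite gt_eqF.
move: h3; rewrite e; lra.
Qed.

(** If [c] were in the discrete spectrum, the spectral family would be locally
    constant, hence constant, on both sides of [c] near [c], so that a small band
    would consist of eigenvectors, which form a finite-dimensional space. *)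
Lemma ess_point_spectrum c : ess_point E c -> ess_spectrum T c%:C.
Proof.
move=> ec; split.
  move=> /resolvent_trivial_band[d d0 h]; apply: (ec d d0).
  by exists 0%N; exact: spanned0.
move=> [[_ [V /nbhs_ballP[e e0 eV] VI]] _ fin].
have eE : e = (complex.Re e)%:C by rewrite RRe_real// gtr0_real.
have {eE}e0 : 0 < complex.Re e /\ e = (complex.Re e)%:C.
  by split=> //; move: e0; rewrite /= eE ltcR.
case: e0 => r0 eE; set r := complex.Re e in r0 eE.
have res x : `|c - x| < r -> x != c -> resolvent_set T x%:C.
  move=> xr xc; apply: contrapT => sx.
  have : (V `&` spectrum T) x%:C.
    split=> //; apply: eV; rewrite -ball_normE/= -rmorphB/= eE.
    by rewrite normc_def/= expr0n/= addr0 sqrtr_sqr ltcR.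
  by rewrite VI => /= -[xE]; move/eqP: xc.
pose d := r / 2.
have d0 : 0 < d by rewrite divr_gt0.
(* intervals of resolvent points carry no spectral projection *)
have triv l m : l <= m -> (forall x, l <= x <= m -> `|c - x| < r /\ x != c) ->
    forall x, band E l m x -> x = 0.
  move=> lm h.
  apply: (@local_to_global R (fun l m => forall x, band E l m x -> x = 0)) => //.
  - by move=> x y x' y' xx _ yy g u /(sub_band xx yy)/g.
  - by move=> x y z xy yz; exact: band_trivial_cat xy yz.
  - by move=> x /h[h1 h2]; exact/resolvent_trivial_band/res.
apply: (ec d d0); apply: finite_dim_sub fin => x bx.
apply: (eigen_of_bands d0) => e' e'0 e'd.
have [b1 b2] := bx.
split.
  apply/eqP; rewrite eq_sym -subr_eq0; apply/eqP.
  apply: (triv (c + e') (c + d)); first lra.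
    move=> y /andP[y1 y2]; split; last by rewrite gt_eqF//; lra.
    by rewrite ltr_norml; apply/andP; split; rewrite /d in y2; lra.
  by have [] := @band_split (c - d) (c + e') (c + d) x ltac:(lra) ltac:(lra) bx.
apply: (triv (c - d) (c - e')); first lra.
  move=> y /andP[y1 y2]; split; last by rewrite lt_eqF//; lra.
  by rewrite ltr_norml; apply/andP; split; rewrite /d in y1; lra.
by have [] := @band_split (c - d) (c - e') (c + d) x ltac:(lra) ltac:(lra) bx.
Qed.

(** As the radius decreases, a band that does not stabilize loses a dimension at
    each change, which can happen only finitely often. *)
Lemma stable_band n c d : 0 < d -> spanned n (band E (c - d) (c + d)) ->
  exists e, [/\ 0 < e, finite_dim (band E (c - e) (c + e)) &
    forall e', 0 < e' -> e' <= e ->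
      band E (c - e) (c + e) `<=` band E (c - e') (c + e')].
Proof.
elim: n d => [|n ih] d d0 sp.
  exists d; split=> //; first by exists 0%N.
  move=> e' _ _ x bx; case: sp => v /(_ _ bx)[a ->].
  by rewrite big_ord0; case: (band_subspace (c - e') (c + e')).
have [st|nst] := pselect (forall e', 0 < e' -> e' <= d ->
      band E (c - d) (c + d) `<=` band E (c - e') (c + e')).
  by exists d; split=> //; exists n.+1.
move: nst => /existsNP[e /not_implyP[e0 /not_implyP[ed]]].
move=> /existsNP[v /not_implyP[bv nbv]].
apply: (ih e) => //.
have le_e : c - e <= c + e by lra.
have be : band E (c - e) (c + e) `<=` band E (c - d) (c + d).
  by apply: sub_band; lra.
pose p := E (c + e) v - E (c - e) v.
have bp : band E (c - e) (c + e) p := band_diff v le_e.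
apply: (@spanned_drop _ _ ip _ _ _ (v - p) sp be).
- have [_ L] := band_subspace (c - d) (c + d).
  by have := L (-1) p v (be _ bp) bv; rewrite scaleN1r (addrC (- p)).
- by apply/eqP => /eqP; rewrite subr_eq0 => /eqP vp; apply: nbv; rewrite vp.
- move=> w bw; have [_ _ Ps] := diff_proj le_e.
  rewrite ipDr ipNr /p -Ps (band_diff_id bw).
  by rewrite subrr.
Qed.

(** [T - z] commutes with [E l], so lower bounds on the two orthogonal components
    of [x] combine by Pythagoras. *)
Lemma combine_below l (z : R[i]) (k : R) x : 0 <= k -> op_dom T x ->
  k * nm (E l x) <= nm (T (E l x) - z *: E l x) ->
  k * nm (x - E l x) <= nm (T (x - E l x) - z *: (x - E l x)) ->
  k * nm x <= nm (T x - z *: x).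
Proof.
move=> k0 dx; have du := spec_dom hip hE l dx.
have hu := spec_idem hE l x; have hw := spec_compl hE l x.
have dw := domB saT dx du.
have : x = E l x + (x - E l x) by rewrite addrC subrK.
move: (E l x) (x - E l x) du hu hw dw => u w du hu hw dw -> h1 h2.
have e : T (u + w) - z *: (u + w) = (T u - z *: u) + (T w - z *: w).
  by rewrite (opD saT)// scalerDr opprD addrACA.
rewrite -ler_sqr ?nnegrE ?mulr_ge0 ?nm_ge0// e exprMn.
rewrite (spec_pythag hip hE hu hw).
have hU : E l (T u - z *: u) = T u - z *: u.
  by rewrite (specB hE) (specZ hE) -(spec_op hip saT hE)// hu.
have hW : E l (T w - z *: w) = 0.
  rewrite (specB hE) (specZ hE) -(spec_op hip saT hE)// hw (op0 saT).
  by rewrite scaler0 subrr.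
rewrite (spec_pythag hip hE hU hW) mulrDr -!exprMn.
by apply: lerD; rewrite ler_sqr ?nnegrE ?mulr_ge0 ?nm_ge0.
Qed.

Lemma outside_below c d x : 0 < d -> op_dom T x ->
  E (c - d) x = x \/ E (c + d) x = 0 -> d * nm x <= nm (T x - c%:C *: x).
Proof.
move=> d0 dx hx.
have [->|x0] := eqVneq x 0; first by rewrite nm0 mulr0 nm_ge0.
have nx : 0 < nm x by rewrite nm_gt0.
rewrite -(ler_pM2r nx) -mulrA -expr2.
case: hx => hx.
- have := form_le hip hE dx hx; have := rip_ge hip (T x - c%:C *: x) x.
  rewrite ripBl ripZl (rip_nm hip); nra.
- have := form_ge hip hE dx hx; have := rip_le hip (T x - c%:C *: x) x.
  rewrite ripBl ripZl (rip_nm hip); nra.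
Qed.

(** If some band around [c] is finite dimensional, a smaller one is stable and
    consists of eigenvectors.  There [T - z] is multiplication by [c - z], while
    off the band [T - c] is bounded below by the radius [d]; so all [z] near [c]
    other than [c] are resolvent points, and [c] itself is either a resolvent
    point or an isolated eigenvalue with eigenspace inside the band. *)
Lemma ess_spectrum_point c : ess_spectrum T c%:C -> ess_point E c.
Proof.
move=> [spc ndisc]; apply: contrapT => /not_ess_point[d0 d00 [n sp]].
have {n sp d0 d00} [d [d0 fin st]] := stable_band d00 sp.
(* distance of a spectral parameter to c, as a real number *)
pose md (z : R[i]) := complex.Re `|c%:C - z|.
have mdE z : `|c%:C - z| = (md z)%:C by rewrite RRe_real// ger0_real.
have md0 z : 0 <= md z by have := normr_ge0 (c%:C - z); rewrite mdE lecR.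
have eig x : band E (c - d) (c + d) x -> op_dom T x /\ T x = c%:C *: x.
  by move=> bx; apply: (eigen_of_bands d0) => e e0 ed; exact: st.
have near_outside (z : R[i]) x : op_dom T x ->
    E (c - d) x = x \/ E (c + d) x = 0 ->
    (d - md z) * nm x <= nm (T x - z *: x).
  move=> dx hx; have h := outside_below d0 dx hx.
  have e : T x - c%:C *: x = (T x - z *: x) - (c%:C - z) *: x.
    by rewrite scalerBl opprB addrA subrK.
  have := nmD (T x - z *: x) (- ((c%:C - z) *: x)); rewrite -e nmN nmZC -/(md z).
  by rewrite mulrBl; lra.
have below (z : R[i]) k : 0 <= k -> k <= d - md z ->
    (forall x, band E (c - d) (c + d) x -> k * nm x <= nm (T x - z *: x)) ->
    forall x, op_dom T x -> k * nm x <= nm (T x - z *: x).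
  move=> k0 kd hb x dx.
  have out y : op_dom T y -> E (c - d) y = y \/ E (c + d) y = 0 ->
      k * nm y <= nm (T y - z *: y).
    move=> dy /(near_outside z y dy); apply: le_trans.
    by rewrite ler_wpM2r ?nm_ge0.
  have dE y l : op_dom T y -> op_dom T (E l y) by exact: (spec_dom hip hE).
  have dc := domB saT dx (dE x (c - d) dx).
  apply: (@combine_below (c - d)) => //.
    by apply: out; [exact: dE|left; exact: spec_idem hE _ _].
  apply: (@combine_below (c + d)) => //; last first.
    by apply: out; [exact: (domB saT dc (dE _ _ dc))|right; exact: (spec_compl hE)].
  apply: hb; split; first exact: spec_idem hE _ _.
  by rewrite (spec_low hE) ?spec_compl//; [exact: spec_compl hE _ _|lra].
have d20 : 0 < d / 2 by rewrite divr_gt0.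
have near_res z : z != c%:C -> md z <= d / 2 -> resolvent_set T z.
  move=> zc zd.
  have m0 : 0 < md z.
    rewrite lt_def md0 andbT -(inj_eq (@complexI R)) -mdE normr_eq0.
    by rewrite subr_eq0 eq_sym.
  have mdc : md (Num.conj z) = md z.
    by rewrite /md -(norm_conjC (c%:C - z)) rmorphB/= conj_real.
  have main w : md w = md z ->
      forall x, op_dom T x -> md z * nm x <= nm (T x - w *: x).
    move=> wz; apply: below => //; first by rewrite wz; lra.
    by move=> x /eig[_ ->]; rewrite -scalerBl nmZC -/(md w) wz.
  exact: (bounded_below_resolvent hip saT m0 (main z erefl) (main _ mdc)).
have [tr|ntr] := pselect (forall x, band E (c - d) (c + d) x -> x = 0).
  apply: spc; have mc : md c%:C = 0 by rewrite /md subrr normr0.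
  have main : forall x, op_dom T x -> d * nm x <= nm (T x - c%:C *: x).
    apply: below; [exact: ltW|by rewrite mc subr0|].
    by move=> x /tr ->; rewrite nm0 mulr0 nm_ge0.
  by apply: (bounded_below_resolvent hip saT d0) => //; rewrite conj_real.
apply: ndisc; split.
- split; first by rewrite inE.
  exists (ball (c%:C : R[i]^o) (d / 2)%:C).
    by apply: nbhsx_ballx; rewrite ltcR.
  apply/seteqP; split=> [z [zb sz]|z ->] /=.
    apply: contrapT => /eqP zc; apply: sz; apply: near_res => //.
    by move: zb; rewrite -ball_normE/= mdE ltcR => /ltW.
  by split=> //; apply: ballxx; rewrite ltcR.
- move: ntr => /existsNP[x /not_implyP[/eig bx /eqP x0]]; by exists x.
- apply: finite_dim_sub fin => x [dx Tx].
  have z0 y : op_dom T y -> T y = c%:C *: y ->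
      E (c - d) y = y \/ E (c + d) y = 0 -> y = 0.
    move=> dy Ty /(outside_below d0 dy).
    rewrite Ty subrr nm0 (pmulr_rle0 _ d0) => h.
    by apply/eqP; rewrite -nm_eq0 eq_le h nm_ge0.
  have Teig l : op_dom T (E l x) /\ T (E l x) = c%:C *: E l x.
    split; first exact: (spec_dom hip hE _ dx).
    by rewrite (spec_op hip saT hE)// Tx (specZ hE).
  split; last first.
    have [d1 e1] := Teig (c - d).
    by apply: z0 => //; left; exact: spec_idem hE _ _.
  have [d1 e1] := Teig (c + d); apply/eqP; rewrite eq_sym -subr_eq0; apply/eqP.
  apply: z0; [exact: (domB saT dx d1)| |right; exact: spec_compl hE _ _].
  by rewrite (opB saT)// Tx e1 scalerBr.
Qed.

End Bands.

(** * Motion of the edges of a spectral gap *)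

Section Perturbation.
Context {R : realType} {H : completeNormedModType R[i]}.
Variable ip : {dot H for (@Num.conj R[i])}.
Hypothesis hip : hilbert_product ip.

Local Notation rip := (rip ip).

Lemma opnorm_bound (B : {linear H -> H}) x : continuous B ->
  nm (B x) <= opnorm B * nm x.
Proof.
move=> /continuous_bounded[M M0 hM].
have [->|x0] := eqVneq x 0; first by rewrite linear0 nm0 mulr0.
have nx : 0 < nm x by rewrite nm_gt0.
rewrite -ler_pdivrMr//; apply: ub_le_sup.
  exists M => _ [y /= y1 <-]; rewrite -/(nm (B y)); apply: (le_trans (hM y)).
  by move: y1; rewrite normE lecR => y1; rewrite ler_piMr// ltW.
exists ((nm x)^-1%:C *: x) => /=.
  by rewrite normE lecR nmZ gtr0_norm ?invr_gt0// mulVf// gt_eqF.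
by rewrite -/(nm _) linearZ/= nmZ gtr0_norm ?invr_gt0// mulrC.
Qed.

(** A bounded symmetric term moves to the other side of the adjoint relation. *)
Lemma perturb_self_adjoint (A : operator H) (B : {linear H -> H}) (t : R) :
  symmetric_op ip B -> self_adjoint ip A -> self_adjoint ip (perturb A B t).
Proof.
move=> symB [[A0 AL] dA adjA]; split=> //.
- split=> //= c x y dx dy; have [d e] := AL c x y dx dy; split=> //.
  rewrite e linearP scalerDr scalerDr !scalerA addrACA.
  by rewrite (mulrC c).
- have conjt : Num.conj (t%:C : R[i]) = t%:C by rewrite conj_real.
  have tB x y : ip (t%:C *: B x) y = ip x (t%:C *: B y).
    by rewrite ipZl ipZr symB conjt.
  move=> y z; have [h1 h2] := adjA y (z - t%:C *: B y).
  split=> [h|[/= dy <-]].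
    have [dy e] : op_dom A y /\ A y = z - t%:C *: B y.
      apply: h1 => x dx; have /= := h x dx.
      by rewrite ipDl tB ipDr ipNr => <-; rewrite addrK.
    by split=> //=; rewrite e subrK.
  move=> x dx /=; rewrite ipDl ipDr tB; congr (_ + _).
  by have [_ h] := adjA y (A y); apply: h.
Qed.

Variables (T T' : operator H) (E E' : R -> H -> H).
Hypothesis saT : self_adjoint ip T.
Hypothesis hE : spectral_family ip T E.
Hypothesis saT' : self_adjoint ip T'.
Hypothesis hE' : spectral_family ip T' E'.
Variables (B : {linear H -> H}) (eps beta : R).
Hypothesis symB : symmetric_op ip B.
Hypothesis beta_ge0 : 0 <= beta.
Hypothesis B_ge0 : forall x, 0 <= rip (B x) x.
Hypothesis B_le : forall x, nm (B x) <= beta * nm x.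
Hypothesis eps0 : 0 <= eps.
Hypothesis domE : op_dom T' = op_dom T.
Hypothesis TE : forall x, T' x = T x + eps%:C *: B x.

Let B_form x : rip (B x) x <= beta * nm x ^+ 2.
Proof.
apply: (le_trans (rip_le hip _ _)); rewrite expr2 mulrA ler_wpM2r ?nm_ge0//.
Qed.

Let B_rsym x y : rip (B x) y = rip (B y) x.
Proof. by rewrite {1}/rip symB -/(rip x (B y)) ripC. Qed.

(** [F l] commutes with [U], so pairing [U x - c x] with the low part of [x] only
    sees the low part; [form_high] is the counterpart for the high part. *)
Lemma form_low (U : operator H) (F : R -> H -> H) l c x :
  self_adjoint ip U -> spectral_family ip U F -> op_dom U x ->
  rip (U x - c%:C *: x) (F l x) <= (l - c) * nm (F l x) ^+ 2.
Proof.
move=> sU hF dx; have hl := spec_idem hF l x.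
have h1 : rip (U x) (F l x) = rip (U (F l x)) (F l x).
  by rewrite (spec_op hip sU hF)// (spec_rsym hF) hl.
have h2 : rip x (F l x) = nm (F l x) ^+ 2.
  by rewrite -(rip_nm hip) (spec_rsym hF) hl.
by have := form_le hip hF (spec_dom hip hF l dx) hl; rewrite ripBl ripZl h1 h2; lra.
Qed.

Lemma form_high (U : operator H) (F : R -> H -> H) l c x :
  self_adjoint ip U -> spectral_family ip U F -> op_dom U x ->
  (l - c) * nm (x - F l x) ^+ 2 <= rip (U x - c%:C *: x) (x - F l x).
Proof.
move=> sU hF dx; have hl := spec_compl hF l x.
have du := spec_dom hip hF l dx; have dw := domB sU dx du.
have := form_ge hip hF dw hl.
have := rip_nm hip (x - F l x).
have o1 : rip (F l x) (x - F l x) = 0.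
  exact: (spec_rorth hF (spec_idem hF l x) hl).
have o2 : rip (U (F l x)) (x - F l x) = 0.
  rewrite /rip (spec_form_orth hip sU hF (l:=l))//; exact: spec_idem hF _ _.
rewrite (opB sU)// !(ripBl ip _ _ (x - F l x)) o1 o2 ripZl !subr0 => ->; lra.
Qed.

(** A gap [(al, b)] of the essential spectrum of [T] shrinks from below by at most
    [eps * beta] when [eps B] is added: both form inequalities cannot hold for an
    approximate eigenvector of [T'] inside the shrunken gap. *)
Lemma gap_upper_edge (al b : R) :
  (forall c, al < c < b -> ~ ess_point E c) ->
  forall c, al + eps * beta < c < b -> ~ ess_point E' c.
Proof.
move=> gap c /andP[alc cb] ec.
have eb0 : 0 <= eps * beta by rewrite mulr_ge0.
(* l is halfway between al and c - eps * beta, m halfway between c and b: the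
   slack of both inequalities below is at least the k defined next. *)
pose l := (al + c - eps * beta) / 2; pose m := (c + b) / 2.
have lm : l <= m by rewrite /l /m; lra.
have fin : finite_dim (band E l m).
  apply: (gap_finite hE) => // x /andP[lx xm]; apply: gap.
  by rewrite /l /m in lx xm; lra.
pose k := Num.min (c - l - eps * beta) (m - c).
have k0 : 0 < k by rewrite lt_min /l /m; lra.
have k1 : k <= c - l - eps * beta by rewrite ge_min lexx.
have k2 : k <= m - c by rewrite ge_min lexx orbT.
clearbody l m k.
have e0 : 0 < k / 4 by lra.
have [x [[b1 b2] x0 Exx]] := exists_off_band hE
  (band_subspace hE' (c - k / 4) (c + k / 4)) (ec _ e0) lm fin.
have dx' := band_dom hip hE' b1 b2.
have dx : op_dom T x by rewrite -domE.
have he := band_norm_le hip saT' hE' e0 (lexx _) (lexx _) b1 b2.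
have := form_low l c saT hE dx; have := form_high m c saT hE dx.
have := spec_pythag hip hE (spec_idem hE l x) (spec_compl hE l x).
rewrite Exx [E l x + _]addrC subrK.
(* With y and z the parts of x below l and above m, and x almost an
   eigenvector of T', the forms of T on y and on z read
     <e - eps B x, y> <= (l - c) |y|^2  and  (m - c) |z|^2 <= <e - eps B x, z>;
   subtracting them cancels the cross term <B y, z>. *)
set y := E l x; set z := x - y; have xE : x = y + z by rewrite addrC subrK.
have -> : T x - c%:C *: x = (T' x - c%:C *: x) - eps%:C *: B x.
  by rewrite TE addrAC addrK.
move: he; set e := T' x - _ => he; clearbody e.
have BxE : B x = B y + B z by rewrite {1}xE linearD.
rewrite BxE !(ripBl ip e) !ripZl !ripDl (B_rsym z y).
have h1 := B_form y; have h2 := B_ge0 z.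
have h3 := rip_ge hip e y; have h4 := rip_le hip e z.
have nx : 0 < nm x by rewrite nm_gt0.
move: (nm_ge0 y) (nm_ge0 z) (nm_ge0 e).
move: (rip (B y) y) (rip (B z) z) (rip (B y) z) (rip e y) (rip e z) h1 h2 h3 h4.
move=> yy zz s ey ez h1 h2 h3 h4 y0 z0 ee0 py hz hy.
have p1 : eps * yy <= eps * (beta * nm y ^+ 2) by rewrite ler_wpM2l.
have p2 : 0 <= eps * zz by rewrite mulr_ge0.
have yx : nm y <= nm x by rewrite -ler_sqr ?nnegrE ?nm_ge0// py lerDl sqr_ge0.
have zx : nm z <= nm x by rewrite -ler_sqr ?nnegrE ?nm_ge0// py lerDr sqr_ge0.
have q1 : nm e * nm y <= k / 4 * nm x * nm x by apply: ler_pM => //; exact: ltW.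
have q2 : nm e * nm z <= k / 4 * nm x * nm x by apply: ler_pM => //; exact: ltW.
have r1 : k * nm y ^+ 2 <= (c - l - eps * beta) * nm y ^+ 2.
  by rewrite ler_wpM2r// sqr_ge0.
have r2 : k * nm z ^+ 2 <= (m - c) * nm z ^+ 2.
  by rewrite ler_wpM2r// sqr_ge0.
have s1 : k * nm x ^+ 2 <= k / 2 * nm x ^+ 2.
  by rewrite [in leLHS]py; lra.
have : 0 < k * nm x ^+ 2 by rewrite mulr_gt0// exprn_gt0.
lra.
Qed.

(** An essential spectral point [al] of [T] is pushed up by at least [eps * kappa]:
    the part [y] below [l] of an approximate eigenvector of [T] at [al] has form
    at least [(al + eps * kappa) |y|^2] up to a small error, since its cross term
    with the part [z] above [m] is almost nonnegative. *)
Lemma gap_lower_edge (al b kappa : R) : ess_point E al ->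
  al + eps * beta < b ->
  (forall m y, m < b -> E' m y = y -> kappa * nm y ^+ 2 <= rip (B y) y) ->
  exists2 c, al + eps * kappa <= c < b & ess_point E' c.
Proof.
move=> ea alb hk; apply: contrapT => nex.
have eb0 : 0 <= eps * beta by rewrite mulr_ge0.
have ness c : al + eps * kappa <= c < b -> ~ ess_point E' c.
  by move=> cI ec; apply: nex; exists c.
pose g := al + eps * kappa; pose m := (al + eps * beta + b) / 2.
have mb : m < b by rewrite /m; lra.
have am : al + eps * beta < m by rewrite /m; lra.
(* If the conclusion fails, finiteness of bands extends a little below g. *)
have [l [lg lm fin]] : exists l, [/\ l < g, l <= m & finite_dim (band E' l m)].
  have [gm|mg] := lerP g m.
    have [|d d0 fd] := @not_ess_point _ _ E' g.
      by apply: ness; rewrite lexx/=; lra.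
    exists (g - d); split; [lra|lra|].
    apply: (finite_band_cat hE' (m := g)) => //; first lra.
      by apply: finite_dim_sub fd; apply: (sub_band hE'); lra.
    apply: (gap_finite hE') => // c /andP[gc cm].
    by apply: ness; rewrite -/g gc/=; lra.
  (* if m < g, the trivial band (m, m] will do *)
  exists m; split=> //; exists 0%N; apply: spanned0 => x [e1 e2].
  by rewrite -e1 e2.
(* q lies strictly between eps * beta and D; eta is chosen so that
   eta + eps * beta <= q and 2 * eta * D^2 < d * (D^2 - q^2). *)
pose D := m - al; pose q := (D + eps * beta) / 2.
have D0 : 0 < D by rewrite /D; lra.
have qD : q < D by rewrite /q /D; lra.
have q0 : 0 <= q by rewrite /q; lra.
have DqD : 0 < D ^+ 2 - q ^+ 2 by nra.
pose d := g - l; have d0 : 0 < d by rewrite /d; lra.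
pose eta := Num.min ((D - eps * beta) / 2) (d * (D ^+ 2 - q ^+ 2) / (4 * D ^+ 2)).
have D20 : 0 < 4 * D ^+ 2 by rewrite mulr_gt0// exprn_gt0.
have eta0 : 0 < eta.
  rewrite lt_min; apply/andP; split; first by rewrite /D; lra.
  by rewrite divr_gt0// mulr_gt0.
have eta1 : eta + eps * beta <= q.
  have : eta <= (D - eps * beta) / 2 by rewrite ge_min lexx.
  by rewrite /q; lra.
have eta2 : eta * (4 * D ^+ 2) <= d * (D ^+ 2 - q ^+ 2).
  by rewrite -ler_pdivlMr// ge_min lexx orbT.
clearbody eta.
have [x [[b1 b2] x0 Exx]] := exists_off_band hE'
  (band_subspace hE (al - eta) (al + eta)) (ea _ eta0) lm fin.
have dx := band_dom hip hE b1 b2.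
have dx' : op_dom T' x by rewrite domE.
have he := band_norm_le hip saT hE eta0 (lexx _) (lexx _) b1 b2.
have := form_low l al saT' hE' dx'; have := form_high m al saT' hE' dx'.
have := spec_pythag hip hE' (spec_idem hE' l x) (spec_compl hE' l x).
rewrite Exx [E' l x + _]addrC subrK.
have hky : kappa * nm (E' l x) ^+ 2 <= rip (B (E' l x)) (E' l x).
  by apply: (hk m) => //; rewrite -Exx (spec_idem hE').
move: hky; set y := E' l x; set z := x - y.
have xE : x = y + z by rewrite addrC subrK.
move=> hky.
have -> : T' x - al%:C *: x = (T x - al%:C *: x) + eps%:C *: B x.
  by rewrite TE addrAC.
move: he; set e := T x - _ => he; clearbody e.
have h5 : rip (e + eps%:C *: B x) z <= q * nm x * nm z.
  apply: (le_trans (rip_le hip _ _)); rewrite ler_wpM2r ?nm_ge0//.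
  apply: (le_trans (nmD _ _)); rewrite nmZ ger0_norm//.
  have : eps * nm (B x) <= eps * (beta * nm x) by rewrite ler_wpM2l.
  have : (eta + eps * beta) * nm x <= q * nm x by rewrite ler_wpM2r ?nm_ge0.
  by lra.
have BxE : B x = B y + B z by rewrite {1}xE linearD.
move: h5; rewrite BxE !(ripDl ip e) !ripZl !ripDl (B_rsym z y).
have h1 := B_form z.
have h3 := rip_ge hip e y; have h4 := rip_le hip e z.
have nx : 0 < nm x by rewrite nm_gt0.
move: (nm_ge0 y) (nm_ge0 z) (nm_ge0 e).
move: (rip (B y) y) (rip (B z) z) (rip (B y) z) (rip e y) (rip e z) hky h1 h3 h4.
move=> yy zz s ey ez hky h1 h3 h4 y0 z0 ee0 h5 py hz hy.
(* D |z|^2 <= <(T' - al) x, z> <= q |x| |z|: the part of x above m is smaller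
   than x by the factor q / D < 1, hence y carries a fixed share of |x|. *)
have zq : D * nm z <= q * nm x.
  have [z00|z00] := eqVneq (nm z) 0; first by rewrite z00 mulr0 mulr_ge0// nm_ge0.
  have zp : 0 < nm z by rewrite lt_def z00.
  by rewrite -(ler_pM2r zp) -mulrA -expr2; exact: le_trans hz h5.
have zq2 : D ^+ 2 * nm z ^+ 2 <= q ^+ 2 * nm x ^+ 2.
  have Dz0 := mulr_ge0 (ltW D0) z0.
  by have := ler_pM Dz0 Dz0 zq zq; rewrite -!expr2 !exprMn.
have p1 : eps * zz <= eps * (beta * nm z ^+ 2) by rewrite ler_wpM2l.
have p2 : eps * (kappa * nm y ^+ 2) <= eps * yy by rewrite ler_wpM2l.
have yx : nm y <= nm x by rewrite -ler_sqr ?nnegrE ?nm_ge0// py lerDl sqr_ge0.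
have zx : nm z <= nm x by rewrite -ler_sqr ?nnegrE ?nm_ge0// py lerDr sqr_ge0.
have q1 : nm e * nm y <= eta * nm x * nm x by apply: ler_pM => //; exact: ltW.
have q2 : nm e * nm z <= eta * nm x * nm x by apply: ler_pM => //; exact: ltW.
have r1 : 0 <= (D - eps * beta) * nm z ^+ 2 by rewrite mulr_ge0 ?sqr_ge0// /D; lra.
(* hz and r1 make the cross term eps <B y, z> nonnegative up to eta |x|^2;
   this is where al + eps * beta < m enters. *)
have s1 : d * nm y ^+ 2 <= 2 * eta * nm x ^+ 2.
  rewrite /d /g; rewrite /D in r1; lra.
have s2 : d * (D ^+ 2 - q ^+ 2) * nm x ^+ 2 <= 2 * eta * D ^+ 2 * nm x ^+ 2.
  have : (D ^+ 2) * (d * nm y ^+ 2) <= D ^+ 2 * (2 * eta * nm x ^+ 2).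
    by rewrite ler_wpM2l ?sqr_ge0.
  have pyD : D ^+ 2 * nm x ^+ 2 = D ^+ 2 * nm y ^+ 2 + D ^+ 2 * nm z ^+ 2.
    by rewrite py mulrDr.
  have : d * ((D ^+ 2 - q ^+ 2) * nm x ^+ 2) <= d * (D ^+ 2 * nm y ^+ 2).
    by rewrite (ler_pM2l d0); lra.
  lra.
rewrite ler_pM2r ?exprn_gt0// in s2.
have := mulr_gt0 d0 DqD; lra.
Qed.

End Perturbation.

(** * Lifting of the edge *)
Unset Implicit Arguments.
Set Strict Implicit.
Set Printing Implicit Defensive.

Theorem corollary3p13 (R : realType) (H : completeNormedModType R[i])
    (ip : {dot H for (@Num.conj R[i])}) (hip : hilbert_product ip)
    (hdim : ~ finite_dim [set: H])
    (A : operator H) (hA : self_adjoint ip A)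
    (B : {linear H -> H}) (hB0 : exists x, B x != 0) (hBbd : continuous B)
    (hBsym : symmetric_op ip B) (hBnneg : nonneg_op ip B)
    (a b : R) (ha : ess_spectrum A a%:C) (hab : a < b)
    (hgap : forall l : R, a < l < b -> ~ ess_spectrum A l%:C)
    (t0 : R) (ht0 : t0 = (b - a) / opnorm B)
    (kappa : R) (hkappa : 0 <= kappa)
    (P : R -> R -> H -> H)
    (hP : forall t, spectral_family ip (perturb A B t) (P t))
    (hBP : forall t, 0 <= t <= 1 -> forall x, range (P t b) x ->
       kappa%:C * `|x| ^+ 2 <= ip x (B x))
    (f : R -> R)
    (hf : forall t, f t =
       sup [set l : R | ess_spectrum (perturb A B t) l%:C /\ l < b]) :
  forall t eps : R, 0 <= t < t0 -> 0 <= eps < t0 - t ->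
    (t + eps <= 1 -> kappa * eps <= f (t + eps) - f t) /\
    f (t + eps) - f t <= opnorm B * eps.
Proof.
have sa t := perturb_self_adjoint t hBsym hA.
have essP t l : ess_spectrum (perturb A B t) l%:C <-> ess_point (P t) l.
  split; first exact: (ess_spectrum_point hip (sa t) (hP t)).
  exact: (ess_point_spectrum hip (sa t) (hP t)).
have A0 : perturb A B 0 = A.
  case: (A) => D g; rewrite /perturb/=; congr Operator.
  by apply/funext => x; rewrite scale0r addr0.
set beta := opnorm B in ht0 *.
have B_le x : nm (B x) <= beta * nm x by exact: opnorm_bound.
have B_ge0 x : 0 <= rip ip (B x) x.
  by have := hBnneg x; rewrite lecE ripC => /andP[].
have beta0 : 0 < beta.
  have [x Bx] := hB0; have := B_le x.
  have : 0 < nm (B x) by rewrite nm_gt0.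
  move=> h1 h2; have := lt_le_trans h1 h2; rewrite ltNge; apply: contraNT.
  by rewrite -leNgt => b0; rewrite mulr_le0_ge0 ?nm_ge0.
have shift t e x : perturb A B (t + e) x = perturb A B t x + e%:C *: B x.
  by rewrite /= rmorphD/= scalerDl addrA.
have upper t e (al : R) : 0 <= e ->
    (forall c, al < c < b -> ~ ess_point (P t) c) ->
    forall c, al + e * beta < c < b -> ~ ess_point (P (t + e)) c.
  move=> e0; exact: (gap_upper_edge hip (sa t) (hP t) (sa (t + e)) (hP (t + e))
    hBsym (ltW beta0) B_ge0 B_le e0 erefl (shift t e)).
have lower t e (al ka : R) : 0 <= e -> ess_point (P t) al ->
    al + e * beta < b ->
    (forall m y, m < b -> P (t + e) m y = y -> ka * nm y ^+ 2 <= rip ip (B y) y) ->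
    exists2 c, al + e * ka <= c < b & ess_point (P (t + e)) c.
  move=> e0; exact: (gap_lower_edge hip (sa t) (hP t) (sa (t + e)) (hP (t + e))
    hBsym (ltW beta0) B_le e0 erefl (shift t e)).
have gap0 c : a < c < b -> ~ ess_point (P 0) c.
  by move=> cI /essP; rewrite A0; exact: hgap.
have ess0 : ess_point (P 0) a by apply/essP; rewrite A0.
(* S t holds the points over which f t is the supremum; it is nonempty and
   bounded as long as the upper edge a + t * beta stays below b. *)
pose S t := [set l : R | ess_spectrum (perturb A B t) l%:C /\ l < b].
have inside t : t < t0 -> a + t * beta < b.
  by rewrite ht0 ltr_pdivlMr// => ?; lra.
have SP t : 0 <= t < t0 -> has_sup (S t) /\ (forall l, S t l -> l <= a + t * beta).
  move=> /andP[t0' tt]; have gapt := upper 0 t a t0' gap0.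
  (* with 0 for kappa the form condition is the positivity of B, at every t *)
  have [|c /andP[_ cb] ec] := lower 0 t a 0 t0' ess0 (inside _ tt).
    by move=> m y _ _; rewrite mul0r.
  rewrite add0r in gapt ec; split.
    by split; [exists c; split=> //; apply/essP|exists b => l [_ /ltW]].
  move=> l [/essP el lb]; rewrite leNgt; apply/negP => al.
  by apply: (gapt l); rewrite ?al.
move=> t eps tI /andP[e0 et].
have [t_ge0 t_lt] := andP tI.
have teI : 0 <= t + eps < t0 by apply/andP; split; lra.
have [hSt St_le] := SP t tI; have [hSte _] := SP (t + eps) teI.
split=> [te1|]; last first.
  rewrite lerBlDl (hf (t + eps)); apply: ge_sup; first by case: hSte.
  move=> l [/essP el lb]; rewrite leNgt; apply/negP => fl.
  apply: (upper t eps (f t) e0 _ l) el; last by rewrite lb andbT; lra.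
  move=> c /andP[fc cb] ec; move: fc; rewrite ltNge => /negP; apply.
  by rewrite hf; apply: ub_le_sup; [case: hSt|split=> //; apply/essP].
rewrite lerBrDl -lerBrDr hf; apply: ge_sup; first by case: hSt.
move=> l Sl; have [/essP el lb] := Sl.
have lt_b : l + eps * beta < b.
  have := inside (t + eps); have := St_le _ Sl.
  case/andP: teI => _ -> h /(_ isT); lra.
have [|c /andP[lc cb] ec] := lower t eps l kappa e0 el lt_b.
  move=> m y mb my.
  have yr : range (P (t + eps) b) y.
    exists y => //; exact: (spec_up_id (hP _) (ltW mb) my).
  have := hBP (t + eps) _ y yr; rewrite te1 (andP teI).1 => /(_ isT).
  rewrite normE -rmorphXn -rmorphM/= lecE/= => /andP[_].
  by rewrite (ripC ip).
have : c <= f (t + eps).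
  by rewrite hf; apply: ub_le_sup; [case: hSte|split=> //; apply/essP].
lra.
Qed.
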